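(* Let $\epsilon \in (0, 2/5]$ and $C > 0$. Then there exists $p_0(\epsilon, C)>0$ such that the following holds. Let $\psi, \theta: \mathbb N\to\mathbb R_{\geq0}$ be finitely supported, $V_{\psi} = \operatorname{supp}\psi$, $W_\theta = \operatorname{supp}\theta$, and let $\mathcal P_{\psi,\theta} = \{ p \text{ prime}: \exists(v,w)\in V_{\psi}\times W_{\theta} \text{ with } p\mid vw \}$ and $P_{\psi, \theta}(\epsilon,C) = p_0(\epsilon, C) + \lvert \mathcal P_{\psi, \theta}\cap [1, p_0(\epsilon, C)]\rvert$. Let $f, g:\mathbb N\to\mathbb R_{\geq 0}$ be multiplicative functions with $(1\star f)(n)\leq n$ and $(1\star g)(n)\leq n$ for all $n\geq 1$. Let $V,W\subseteq \mathbb N$, $t\geq 1$, $K\in\mathbb R$, and suppose $\mathcal E \subset \mathcal E_{\psi,\theta}^{t, K}\cap(V\times W)$. Then $$\mu_{\psi,\theta}^{f,g}(\mathcal E) \leq (100e^{C})^{P_{\psi,\theta}(\epsilon, C)}(\operatorname{Log} t)^{\frac{1}{2}(e^{40C}-1)}\big(\mu_{\psi}^{f}(V)\mu_{\theta}^{g}(W)e^{-CK}\big)^{\frac{1}{2}+\epsilon}.$$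
   Context: Primes are denoted $p$. For $v,w\in\mathbb N$ and real $t\geq1$, $\omega_t(v,w) = \lvert\{ p\leq t : p\mid \frac{vw}{\gcd(v,w)^2}\}\rvert$. For $\psi,\theta:\mathbb N\to\mathbb R_{\ge0}$, $D_{\psi,\theta}(v,w) = \frac{\max(w\psi(v),v\theta(w))}{\gcd(v,w)}$. For $f:\mathbb N\to\mathbb R_{\ge0}$ and $v\in\mathbb N$, $\mu_\psi^f(v)=\frac{f(v)\psi(v)}{v}$; for $V\subseteq\mathbb N$, $\mu_\psi^f(V)=\sum_{v\in V}\mu_\psi^f(v)$; for $\mathcal E\subseteq\mathbb N\times\mathbb N$, $\mu_{\psi,\theta}^{f,g}(\mathcal E)=\sum_{(v,w)\in\mathcal E}\mu_\psi^f(v)\mu_\theta^g(w)$. With $V_\psi=\operatorname{supp}\psi$, $W_\theta=\operatorname{supp}\theta$, $t\ge1$, $K\in\mathbb R$: $\mathcal E_{\psi,\theta}^{t,K}=\{(v,w)\in V_\psi\times W_\theta : D_{\psi,\theta}(v,w)\le 1,\ \omega_t(v,w)\ge K\}$. $(1\star f)(n)=\sum_{d\mid n} f(d)$ is Dirichlet convolution. $\operatorname{Log} t=\max\{1,\log t\}$. *)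

(* Defs.v *)
From HB Require Import structures.
From mathcomp Require Import all_boot all_order all_algebra.
From mathcomp Require Import all_classical all_reals all_analysis.
Set Implicit Arguments. Unset Strict Implicit. Unset Printing Implicit Defensive.
Import Order.TTheory GRing.Theory Num.Theory.
Local Open Scope classical_set_scope.
Local Open Scope ring_scope.

Section Defs.
Variable R : realType.

Definition rcard (S : set nat) : R := \sum_(p \in S) (1 : R).

Definition omega_t (t : R) (v w : nat) : R :=
  rcard [set p | prime p /\ p%:R <= t /\ (p %| (v * w) %/ (gcdn v w ^ 2))%N].

Definition Dpt (psi theta : nat -> R) (v w : nat) : R :=
  Num.max (w%:R * psi v) (v%:R * theta w) / (gcdn v w)%:R.

Definition mu (f psi : nat -> R) (v : nat) : R := f v * psi v / v%:R.

Definition mu_set (f psi : nat -> R) (V : set nat) : R :=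
  \sum_(v \in V) mu f psi v.

Definition mu2 (f g psi theta : nat -> R) (E : set (nat * nat)) : R :=
  \sum_(x \in E) (mu f psi x.1 * mu g theta x.2).

(* supp psi, as a subset of N = {1,2,...} *)
Definition supp (psi : nat -> R) : set nat := [set n | (0 < n)%N /\ psi n != 0].

Definition Eset (psi theta : nat -> R) (t K : R) : set (nat * nat) :=
  [set x | supp psi x.1 /\ supp theta x.2 /\
           Dpt psi theta x.1 x.2 <= 1 /\ K <= omega_t t x.1 x.2].

Definition Pset (psi theta : nat -> R) : set nat :=
  [set p | prime p /\ exists v w, supp psi v /\ supp theta w /\ (p %| v * w)%N].

Definition Pval (psi theta : nat -> R) (p0 : R) : R :=
  p0 + rcard (Pset psi theta `&` [set p | (1 <= p)%N /\ p%:R <= p0]).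

Definition one_conv (f : nat -> R) (n : nat) : R := \sum_(d <- divisors n) f d.

Definition mult_fun (f : nat -> R) : Prop :=
  f 1%N = 1 /\ forall m n, (0 < m)%N -> (0 < n)%N -> coprime m n ->
    f (m * n)%N = f m * f n.

Definition Logt (t : R) : R := Num.max 1 (ln t).

End Defs.

(* Main.v *)
(** Put [s = 1/2 + eps], [x_v = psi v / v] and [y_w = theta w / w], so that the
    condition [D <= 1] reads [x_v, y_w <= 1 / lcm(v, w)].  The primes dividing the
    supports are removed one at a time.  Splitting the edges according to the
    exponents [(i, j)] of [p] in [(v, w)] and bounding each class inductively costs
    the factor
      [sum_(i,j) (a_i b_j p^-|i-j|)^(1-s) (al_i be_j)^s],
    where [al_i], [be_j] are the proportions of the masses carried by the exponents
    and [a_i = f(p^i) / p^i], [b_j = g(p^j) / p^j].  It is at most [100] always and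
    at most [1] for large [p], unless both masses sit on a common exponent [k] up to
    about [1/p].  In that case the classes [(k, k)], [(k, k+1)], [(k+1, k)] are kept
    together: [p] then no longer divides the gcd of the remaining parts of [v] and
    [w], and the loss from the classes [(k-1, k)], [(k, k-1)] is compensated by
    [a_k + a_(k-1) / p <= 1], a consequence of [(1 * f)(n) <= n].  The factor becomes
    [1 + O(p^(-1-eps/8))], with an extra [O(1/p)] for [p <= t] caused by the weight
    [e^(C omega_t)].  When all primes are used up, the surviving parts of [v] and
    [w] are coprime, and Cauchy-Schwarz with the weights [r / r'] together with the
    mean value of [e^(c omega_t)] gives the bound. *)
Require Import Defs.
From HB Require Import structures.
From mathcomp Require Import all_boot all_order all_algebra.
From mathcomp Require Import all_classical all_reals all_analysis.
From mathcomp Require Import ring lra zify.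
Set Implicit Arguments. Unset Strict Implicit. Unset Printing Implicit Defensive.
Import Order.TTheory GRing.Theory Num.Theory.
Local Open Scope classical_set_scope.
Local Open Scope ring_scope.

(** * Real inequalities *)

Section RealInequalities.
Variable R : realType.
Implicit Types s u v x y z P : R.

(** The factors are multiplied over all primes, so for [p > t] even a loss [c / p] is too much,
    while [p^(-1-delta)] is summable. This forces the compensation to be exact to first order at a
    common exponent [k]; for [p <= t] a true [1 / p] remains, and its sum, of size [ln (Logt t)],
    produces the power of [Logt t]. The surplus [s - 1/2] enters twice. In the local factor the
    diagonal terms [(al_i be_i)^(1/2)] already sum to at most [1], and the surplus power is a gain
    unless the masses concentrate. At the end Cauchy-Schwarz gives only the exponent [1/2], and [s]
    comes from interpolation with the trivial bound, the product of the two masses; hence the power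
    [1 - s] on all weights and the base [e^(C s / (1 - s))] for the omega weight. The constant [100]
    and the bound [s <= 9/10] belong together: [2^(-(1-s))] has to stay away from [1] for a
    geometric kernel to have row sums at most [100]. Finally [p0] has two roles: it separates the
    primes that pay [100 e^C] from the others, and as a summand of the exponent it absorbs all
    constants depending on [eps] and [C] only. *)

Lemma powRDpos P a b : 0 < P -> P `^ (a + b) = P `^ a * P `^ b.
Proof. by move=> P0; rewrite powRD// (gt_eqF P0)/= implybT. Qed.

Lemma le_powR s u v : 0 <= s -> 0 <= u -> u <= v -> u `^ s <= v `^ s.
Proof.
move=> s0 u0 uv; apply: ge0_ler_powR => //; rewrite nnegrE//.
exact: le_trans uv.
Qed.

Lemma powR_le1 s u : 0 <= s -> 0 <= u -> u <= 1 -> u `^ s <= 1.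
Proof. by move=> s0 u0 u1; rewrite (le_trans (le_powR s0 u0 u1))// powR1. Qed.

Lemma powR_ge1 s u : 0 <= s -> 1 <= u -> 1 <= u `^ s.
Proof. by move=> s0 /(le_powR s0 ler01); rewrite powR1. Qed.

(** Weighted arithmetic-geometric mean: [ln] lies below its tangent line at the mean [m], and the
    weighted sum of the two tangent bounds is exactly [ln m]. *)
Lemma powR_young s u v : 0 < s < 1 -> 0 <= u -> 0 <= v ->
  u `^ s * v `^ (1 - s) <= s * u + (1 - s) * v.
Proof.
move=> /andP[s0 s1] u0 v0.
have [->|un0] := eqVneq u 0.
  rewrite powR0 ?gt_eqF// mul0r mulr0 add0r mulr_ge0//; lra.
have [->|vn0] := eqVneq v 0.
  rewrite (@powR0 _ (1 - s)) ?gt_eqF ?subr_gt0// !mulr0 addr0 mulr_ge0//; exact: ltW.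
have up : 0 < u by rewrite lt_neqAle eq_sym un0.
have vp : 0 < v by rewrite lt_neqAle eq_sym vn0.
set m := s * u + (1 - s) * v; have mp : 0 < m by rewrite /m; nra.
have lnb w : 0 < w -> ln w <= ln m + w / m - 1.
  move=> w0; have -> : w = m * (1 + (w / m - 1)) by field; rewrite gt_eqF.
  rewrite lnM ?posrE//; last by rewrite addrC subrK divr_gt0.
  have := @le_ln1Dx R (w / m - 1); rewrite ltrBrDl subrr divr_gt0// => /(_ isT).
  have -> : m * (1 + (w / m - 1)) / m = w / m by field; rewrite gt_eqF.
  lra.
rewrite /powR (negPf un0) (negPf vn0) -expRD -[leRHS]lnK ?posrE// ler_expR.
have h1 := lnb _ up; have h2 := lnb _ vp.
have e : s * (u / m) + (1 - s) * (v / m) = 1.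
  by rewrite /m; field; rewrite gt_eqF.
have h3 : s * ln u <= s * (ln m + u / m - 1) by rewrite ler_pM2l.
have h4 : (1 - s) * ln v <= (1 - s) * (ln m + v / m - 1) by rewrite ler_pM2l// subr_gt0.
lra.
Qed.

Lemma powR_bernoulli s z : 0 < s < 1 -> 0 <= z <= 1 -> (1 - z) `^ s <= 1 - s * z.
Proof.
move=> s01 /andP[z0 z1]; have := @powR_young s (1 - z) 1 s01.
rewrite powR1 mulr1 => h; apply: (le_trans (h _ _)); lra.
Qed.

(** Young's inequality with exponent [1/r] for the numbers [1 + r u] and [1] bounds
    [(1 + r u)^(1/r)] by [1 + u]. *)
Lemma powR_bernoulli_ge (r u : R) : 1 <= r -> 0 <= u -> 1 + r * u <= (1 + u) `^ r.
Proof.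
move=> r1 u0; have [->|rn] := eqVneq r 1; first by rewrite powRr1 ?mul1r//; lra.
have r0 : 0 < r by lra.
have ri : 0 < r^-1 < 1.
  rewrite invr_gt0 r0/= invf_lt1//; rewrite lt_neqAle eq_sym rn//.
have h := @powR_young r^-1 (1 + r * u) 1 ri.
rewrite powR1 mulr1 in h.
have h2 : (1 + r * u) `^ r^-1 <= 1 + u.
  apply: (le_trans (h _ _)) => //; first by nra.
  have -> : r^-1 * (1 + r * u) + (1 - r^-1) * 1 = 1 + u.
    by field; rewrite gt_eqF.
  by [].
have -> : 1 + r * u = ((1 + r * u) `^ r^-1) `^ r.
  by rewrite -powRrM mulVf ?gt_eqF// powRr1//; nra.
by apply: le_powR; rewrite ?powR_ge0//; lra.
Qed.

Lemma powR_small (g c : R) : 0 < g -> 0 < c ->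
  exists P0 : R, 0 < P0 /\ forall P, P0 <= P -> P `^ (- g) <= c.
Proof.
move=> g0 c0; exists (c `^ (- g^-1)); split; first exact: powR_gt0.
move=> P hP; have P0 : 0 < P by apply: lt_le_trans hP; exact: powR_gt0.
rewrite powRN invf_ple ?posrE ?powR_gt0//.
have -> : c^-1 = (c `^ (- g^-1)) `^ g.
  by rewrite -powRrM mulNr mulVf ?gt_eqF// powR_inv1// ltW.
by apply: le_powR => //; [exact: ltW|exact: powR_ge0].
Qed.

(* [(u v)^s <= (u v)^(1/2) <= (u + v) / 2]. *)
Lemma powR_mean s u v : 1 / 2 <= s -> 0 <= u <= 1 -> 0 <= v <= 1 ->
  (u * v) `^ s <= (u + v) / 2.
Proof.
move=> s1 /andP[u0 u1] /andP[v0 v1].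
have [->|uv] := eqVneq (u * v) 0.
  rewrite powR0; last by rewrite gt_eqF//; lra.
  by lra.
have uv0 : 0 < u * v by rewrite lt_neqAle eq_sym uv mulr_ge0.
apply: (@le_trans _ _ ((u * v) `^ (1/2))).
  by apply: ger_powR => //; rewrite uv0/=; nra.
rewrite powRM//.
have e : (1 : R) / 2 = 1 - 1 / 2 by lra.
rewrite {2}e; apply: le_trans (powR_young _ _ _) _ => //; lra.
Qed.

(** A Schur test. Once [al] and [be] are normalised to total mass [1], their entries lie in [[0, 1]]
    and [powR_mean] splits each term into the average of a row and a column contribution; each half
    sums to at most [W / 2]. *)
Lemma kernel_sum n (w : nat -> nat -> R) (W s : R) (al be : nat -> R) :
  1 / 2 <= s ->
  (forall i j, 0 <= w i j) ->
  (forall i, (i < n)%N -> \sum_(j < n) w i j <= W) ->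
  (forall j, (j < n)%N -> \sum_(i < n) w i j <= W) ->
  (forall i, 0 <= al i) -> (forall i, 0 <= be i) ->
  \sum_(i < n) \sum_(j < n) w i j * (al i * be j) `^ s <=
  W * ((\sum_(i < n) al i) * (\sum_(i < n) be i)) `^ s.
Proof.
move=> s1 w0 rW cW al0 be0.
have s0 : s != 0 by rewrite gt_eqF//; lra.
set X := \sum_(i < n) al i; set Y := \sum_(i < n) be i.
have alX (i : 'I_n) : al i <= X.
  by rewrite /X (bigD1 i)//= lerDl sumr_ge0.
have beY (i : 'I_n) : be i <= Y.
  by rewrite /Y (bigD1 i)//= lerDl sumr_ge0.
have X0 : 0 <= X by rewrite sumr_ge0.
have Y0 : 0 <= Y by rewrite sumr_ge0.
have [XY|XYn] := eqVneq (X * Y) 0.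
  rewrite XY powR0// mulr0 big1// => i _; rewrite big1// => j _.
  have -> : al i * be j = 0.
    apply/eqP; rewrite eq_le mulr_ge0// andbT -XY; exact: ler_pM.
  by rewrite powR0// mulr0.
move: XYn; rewrite mulf_eq0 negb_or => /andP[Xn Yn].
have Xp : 0 < X by rewrite lt_neqAle eq_sym Xn.
have Yp : 0 < Y by rewrite lt_neqAle eq_sym Yn.
pose XYs := (X * Y) `^ s.
have XYs0 : 0 <= XYs by exact: powR_ge0.
have term (i j : 'I_n) : w i j * (al i * be j) `^ s <=
   XYs * (w i j * (al i / X) / 2 + w i j * (be j / Y) / 2).
  have -> : al i * be j = (X * Y) * ((al i / X) * (be j / Y)).
    by field; rewrite Xn Yn.
  rewrite powRM ?mulr_ge0 ?invr_ge0//.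
  have -> : w i j * (al i / X) / 2 + w i j * (be j / Y) / 2 = w i j * ((al i / X + be j / Y) / 2).
    by ring.
  rewrite mulrCA ler_wpM2l// ler_wpM2l//.
  by apply: powR_mean => //; rewrite divr_ge0//= ler_pdivrMr ?mul1r.
apply: (le_trans (ler_sum _ (fun i _ => ler_sum _ (fun j _ => term i j)))).
under eq_bigr => i _.
  rewrite -mulr_sumr big_split/=.
  over.
rewrite -mulr_sumr mulrC ler_wpM2r//.
rewrite big_split/= [X in _ + X <= _]exchange_big/=.
have -> : W = W / 2 + W / 2 by lra.
have one : \sum_(i < n) al i / X = 1 by rewrite -mulr_suml divff.
have onb : \sum_(i < n) be i / Y = 1 by rewrite -mulr_suml divff.
apply: lerD.
  have -> : W / 2 = \sum_(i < n) al i / X * (W / 2) by rewrite -mulr_suml one mul1r.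
  apply: ler_sum => i _.
  have -> : \sum_(j < n) w i j * (al i / X) / 2 = (al i / X) * ((\sum_(j < n) w i j) / 2).
    by rewrite mulr_suml mulr_sumr; apply: eq_bigr => j _; ring.
  by rewrite ler_wpM2l ?divr_ge0// ler_pM2r ?rW.
have -> : W / 2 = \sum_(i < n) be i / Y * (W / 2) by rewrite -mulr_suml onb mul1r.
apply: ler_sum => j _.
have -> : \sum_(i < n) w i j * (be j / Y) / 2 = (be j / Y) * ((\sum_(i < n) w i j) / 2).
  by rewrite mulr_suml mulr_sumr; apply: eq_bigr => i _; ring.
by rewrite ler_wpM2l ?divr_ge0// ler_pM2r ?cW.
Qed.

Lemma sum1_le1 n (al : nat -> R) : (forall i, 0 <= al i) ->
  \sum_(i < n) al i = 1 -> forall i, (i < n)%N -> al i <= 1.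
Proof.
by move=> al0 <- i i_n; rewrite (bigD1 (Ordinal i_n))//= lerDl sumr_ge0.
Qed.

Definition ndist (i j : nat) : nat := (i - j + (j - i))%N.

Lemma ndistC i j : ndist i j = ndist j i.
Proof. by rewrite /ndist addnC. Qed.

Lemma ndist_eq0 i j : (ndist i j == 0)%N = (i == j).
Proof. by rewrite /ndist addn_eq0 !subn_eq0 eqn_leq. Qed.

Lemma ndistnn i : ndist i i = 0%N.
Proof. by apply/eqP; rewrite ndist_eq0. Qed.

Lemma ndistSn j : ndist j.+1 j = 1%N.
Proof. by rewrite /ndist; lia. Qed.

Lemma ndist_ge2 k j : j != k -> j != k.+1 -> j.+1 != k -> (2 <= ndist k j)%N.
Proof. by rewrite /ndist; lia. Qed.

Lemma succn_eq j k : (0 < k)%N -> (j.+1 == k) = (j == k.-1).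
Proof. lia. Qed.

Lemma geometric_le (q : R) n : 0 <= q -> q < 1 -> \sum_(i < n) q ^+ i <= (1 - q)^-1.
Proof.
move=> q0 q1; have q1' : 0 < 1 - q by rewrite subr_gt0.
rewrite -[leRHS]mul1r ler_pdivlMr//.
have -> : (\sum_(i < n) q ^+ i) * (1 - q) = 1 - q ^+ n.
  by rewrite -opprB mulrN mulrC -subrX1 opprB.
by rewrite lerBlDr lerDl exprn_ge0.
Qed.

(** The indices below [i] and those above [i] each give part of the series of [q^d] over [d >= 1];
    hence the factor [2]. *)
Lemma sum_ndist_pos (q : R) n i : 0 <= q -> q < 1 ->
  \sum_(j < n | j != i :> nat) q ^+ ndist i j <= 2 * q / (1 - q).
Proof.
move=> q0 q1; have q1' : 0 < 1 - q by rewrite subr_gt0.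
rewrite (bigID (fun j : 'I_n => (j < i)%N))/=.
have -> : 2 * q / (1 - q) = q / (1 - q) + q / (1 - q) by lra.
have g m : \sum_(j < m) q ^+ j.+1 <= q / (1 - q).
  under eq_bigr do rewrite exprS.
  by rewrite -mulr_sumr ler_wpM2l// geometric_le.
apply: lerD.
- apply: le_trans (g i).
  rewrite [leRHS](reindex_inj rev_ord_inj)/=.
  rewrite -(big_mkord xpredT (fun j => q ^+ (i - j.+1).+1)).
  rewrite -(big_mkord (fun j => (j != i) && (j < i)%N) (fun j => q ^+ ndist i j)).
  rewrite [leLHS]big_mkcond [leRHS]big_mkcond/=.
  have -> : \sum_(0 <= j < n) (if (j != i) && (j < i)%N then q ^+ ndist i j else 0) =
    \sum_(0 <= j < n) (if (j < i)%N then q ^+ (i - j.+1).+1 else 0).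
    apply: eq_bigr => j _; case: ltnP => h; rewrite ?andbF// (ltn_eqF h)/=.
    by congr (_ ^+ _); rewrite /ndist; lia.
  have [ni|ni] := leqP n i.
    rewrite [leRHS](big_cat_nat _ (n := n))//=.
    rewrite -[leLHS]addr0 lerD//; last by rewrite sumr_ge0// => j _; rewrite exprn_ge0.
    rewrite !big_mkord; apply: ler_sum => j _.
    by rewrite (leq_trans (ltn_ord j) ni).
  rewrite (big_cat_nat _ (n := i))//= ?(ltnW ni)//.
  have -> : \sum_(i <= j < n) (if (j < i)%N then q ^+ (i - j.+1).+1 else 0) = 0 :> R.
    by rewrite big_nat big1// => j /andP[h _]; rewrite ltnNge h.
  by rewrite addr0 !big_mkord; apply: ler_sum => j _; rewrite ltn_ord.
- apply: le_trans (g n).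
  rewrite -(big_mkord xpredT (fun j => q ^+ j.+1)).
  rewrite -(big_mkord (fun j => (j != i) && ~~ (j < i)%N) (fun j => q ^+ ndist i j)).
  have -> : \sum_(0 <= j < n | (j != i) && ~~ (j < i)%N) q ^+ ndist i j =
    \sum_(0 <= j < n | (i.+1 <= j)%N) q ^+ (j - i).
    apply: eq_big => [j|j]; first by lia.
    by move=> h; congr (_ ^+ _); rewrite /ndist; lia.
  have [ni|ni] := leqP n i.+1.
    have -> : \sum_(0 <= j < n | (i.+1 <= j)%N) q ^+ (j - i) = 0 :> R.
      by rewrite big_nat_cond big1// => j; lia.
    by rewrite sumr_ge0// => j _; rewrite exprn_ge0.
  rewrite (big_cat_nat _ (n := i.+1))//=; last exact: ltnW.
  have -> : \sum_(0 <= j < i.+1 | (i.+1 <= j)%N) q ^+ (j - i) = 0 :> R.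
    by rewrite big_nat_cond big1// => j; lia.
  rewrite add0r big_nat_cond.
  rewrite (eq_bigl (fun j => (i.+1 <= j < n)%N)); last by move=> j; lia.
  rewrite -big_nat -{1}[i.+1]add0n big_addn.
  rewrite [leRHS](big_cat_nat _ (n := (n - i.+1)%N))//=; last by lia.
  rewrite -[leLHS]addr0 lerD//; last by rewrite sumr_ge0// => j _; rewrite exprn_ge0.
  rewrite !big_mkord; apply: ler_sum => j _.
  by rewrite (_ : (j + i.+1 - i = j.+1)%N)//; lia.
Qed.

End RealInequalities.

(** * The local factor at a prime *)

Section LocalFactor.
Variables (R : realType) (s : R).
Hypotheses (s_gt : 1 / 2 < s) (s_le : s <= 9 / 10).
Implicit Types (h P tau z : R) (a b al be : nat -> R).

Local Ltac slra := move: (s_gt) (s_le); lra.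

(** Cost of the exponent class [(i, j)]: [P] is the prime as a real number and [h] the price of an
    exponent difference, [e^(C s)] for primes up to [t] and [1] beyond. *)
Definition local_term h P a b al be (i j : nat) : R :=
  (a i * b j / P ^+ ndist i j) `^ (1 - s) * (al i * be j) `^ s *
  (if i == j then 1 else h).

Definition tame_exp (k i : nat) : bool := (i == k) || (i == k.+1).

Definition tame_pair (k i j : nat) : bool :=
  [&& tame_exp k i, tame_exp k j & (i == k) || (j == k)].

Let qq P : R := P `^ (- (1 - s)).

Lemma powR_expn_inv P n : 0 < P -> (P ^+ n)^-1 `^ (1 - s) = qq P ^+ n.
Proof.
move=> P0; rewrite -(powR_mulrn n (powR_ge0 _ _)) /qq -powRrM.
rewrite -(powR_mulrn n (ltW P0)) -powRN -powRrM; congr (_ `^ _); ring.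
Qed.

(** From [1 - s >= 1/10] the tenth power is at most [1/2 < (99/101)^10]. The number [99/101] solves
    [1 + 2 q / (1 - q) = 100], and for it [2 / (1 - q) = 101]: these are the constants [100] and
    [101] of the kernel bounds. *)
Lemma qq_le P : 2 <= P -> 0 <= qq P <= 99 / 101.
Proof.
move=> P2; have P0 : 0 < P by lra.
rewrite powR_ge0/= leNgt; apply/negP => hq.
have h1 : (99 / 101) ^+ 10 <= qq P ^+ 10 by rewrite lerXn2r ?nnegrE ?powR_ge0 ?ltW//; lra.
have h2 : qq P ^+ 10 <= 1 / 2.
  rewrite /qq -powR_mulrn ?powR_ge0// -powRrM.
  apply: (@le_trans _ _ (P `^ (-1))).
    by apply: ler_powR; slra.
  by rewrite powR_inv1 ?(ltW P0)// mul1r lef_pV2 ?posrE//; lra.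
have h3 : (1 / 2 : R) < (99 / 101) ^+ 10 by rewrite !exprS expr0; lra.
lra.
Qed.

Lemma sum_off_le P n i : 2 <= P ->
  \sum_(j < n) (if i == j :> nat then 0 else qq P ^+ ndist i j) <= 101 * qq P.
Proof.
move=> P2; have /andP[q0 q1] := qq_le P2.
have -> : \sum_(j < n) (if i == j :> nat then 0 else qq P ^+ ndist i j) =
  \sum_(j < n | j != i :> nat) qq P ^+ ndist i j.
  by rewrite [RHS]big_mkcond/=; apply: eq_bigr => j _; rewrite eq_sym; case: eqP.
apply: le_trans (sum_ndist_pos n i q0 _) _; first by lra.
rewrite ler_pdivrMr; [nra|lra].
Qed.

Lemma sum_all_le P n i : 2 <= P -> (i < n)%N ->
  \sum_(j < n) qq P ^+ ndist i j <= 100.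
Proof.
move=> P2 in_; have /andP[q0 q1] := qq_le P2.
rewrite (bigD1 (Ordinal in_))//= ndistnn expr0.
have q11 : qq P < 1 by lra.
have := sum_ndist_pos n i q0 q11.
have -> : \sum_(j < n | j != i :> nat) qq P ^+ ndist i j =
  \sum_(j < n | j != Ordinal in_) qq P ^+ ndist i j by apply: eq_bigl.
move=> h; have : 2 * qq P / (1 - qq P) <= 99 by rewrite ler_pdivrMr; lra.
lra.
Qed.

Section Weights.
Variables (h P : R) (n : nat) (a b al be : nat -> R).
Hypotheses (h_ge1 : 1 <= h) (P_ge2 : 2 <= P).
Hypotheses (a01 : forall i, 0 <= a i <= 1) (b01 : forall i, 0 <= b i <= 1).
Hypotheses (al_ge0 : forall i, 0 <= al i) (be_ge0 : forall i, 0 <= be i).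
Hypotheses (al_sum : \sum_(i < n) al i = 1) (be_sum : \sum_(i < n) be i = 1).

Local Ltac wlra := move: (s_gt) (s_le) (h_ge1) (P_ge2); lra.
Notation q := (qq P).
Notation lt := (local_term h P a b al be).
Let H : R := h `^ (1 - s)^-1.

Let P0 : 0 < P. Proof. by wlra. Qed.
Let s0 : s != 0. Proof. by rewrite gt_eqF//; wlra. Qed.
Let s01 : 0 < s < 1. Proof. by apply/andP; split; wlra. Qed.
Let s12 : 1 / 2 <= s. Proof. by wlra. Qed.
Let q_ge0 : 0 <= q. Proof. exact: powR_ge0. Qed.
Let h_ge0 : 0 <= h. Proof. by wlra. Qed.

Lemma kernel_all (u v : nat -> R) :
  (forall i, 0 <= u i) -> (forall i, 0 <= v i) ->
  \sum_(i < n) \sum_(j < n) q ^+ ndist i j * (u i * v j) `^ s <=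
  100 * ((\sum_(i < n) u i) * (\sum_(i < n) v i)) `^ s.
Proof.
move=> u0 v0; apply: (kernel_sum (w := fun i j => q ^+ ndist i j)) => //.
- by move=> i j; rewrite exprn_ge0.
- by move=> i i_n; exact: sum_all_le.
- move=> i i_n; under eq_bigr do rewrite ndistC; exact: sum_all_le.
Qed.

Lemma kernel_off (u v : nat -> R) :
  (forall i, 0 <= u i) -> (forall i, 0 <= v i) ->
  \sum_(i < n) \sum_(j < n) (if i == j :> nat then 0 else q ^+ ndist i j) * (u i * v j) `^ s <=
  101 * q * ((\sum_(i < n) u i) * (\sum_(i < n) v i)) `^ s.
Proof.
move=> u0 v0.
apply: (kernel_sum (w := fun i j => if i == j then 0 else q ^+ ndist i j)) => //.
- by move=> i j; case: eqP => // _; rewrite exprn_ge0.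
- by move=> i i_n; exact: sum_off_le.
- move=> i i_n; under eq_bigr do rewrite ndistC eq_sym; exact: sum_off_le.
Qed.

Lemma local_weight_le i j :
  (a i * b j / P ^+ ndist i j) `^ (1 - s) <= q ^+ ndist i j.
Proof.
have /andP[ai0 ai1] := a01 i; have /andP[bj0 bj1] := b01 j.
rewrite -powR_expn_inv//; apply: le_powR; first by wlra.
  by rewrite !mulr_ge0// invr_ge0 exprn_ge0 ?ltW.
have iP : 0 <= (P ^+ ndist i j)^-1 by rewrite invr_ge0 exprn_ge0 ?ltW.
by rewrite -[leRHS]mul1r; apply: ler_wpM2r => //; nra.
Qed.

Lemma local_term_le i j : lt i j <= h * (q ^+ ndist i j * (al i * be j) `^ s).
Proof.
rewrite /local_term [leRHS]mulrC; apply: ler_pM.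
- by rewrite mulr_ge0// powR_ge0.
- by case: eqP => _ //; wlra.
- by apply: ler_wpM2r; [exact: powR_ge0|exact: local_weight_le].
- by case: eqP => _ //; wlra.
Qed.

Lemma local_term_diag_le i : lt i i <= (al i * be i) `^ s.
Proof.
rewrite /local_term eqxx mulr1 -[leRHS]mul1r ler_wpM2r ?powR_ge0//.
by have := local_weight_le i i; rewrite ndistnn expr0.
Qed.

Lemma local_term_off_le i j : i != j ->
  lt i j <= h * ((if i == j then 0 else q ^+ ndist i j) * (al i * be j) `^ s).
Proof. by move=> ij; rewrite (negPf ij); exact: local_term_le. Qed.

Lemma local_all : \sum_(i < n) \sum_(j < n) lt i j <= 100 * h.
Proof.
have pt (i j : 'I_n) := local_term_le i j.
apply: le_trans (ler_sum _ (fun i _ => ler_sum _ (fun j _ => pt i j))) _.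
under eq_bigr do rewrite -mulr_sumr.
rewrite -mulr_sumr [leRHS]mulrC ler_wpM2l//.
have := kernel_all al_ge0 be_ge0.
by rewrite al_sum be_sum mulr1 powR1 mulr1.
Qed.

Lemma sum_diag (F : nat -> R) :
  \sum_(i < n) \sum_(j < n) (if i == j :> nat then F i else 0) = \sum_(i < n) F i.
Proof.
apply: eq_bigr => i _; rewrite (bigD1 i)//= eqxx big1 ?addr0// => j ji.
by rewrite eq_sym (inj_eq val_inj) (negPf ji).
Qed.

(* No exponent carries almost all of both masses: splitting everything is free. *)
Lemma local_flat tau :
  (forall i, (i < n)%N ->
     (a i * b i) `^ (1 - s) * (al i * be i) `^ (s - 1 / 2) <= 1 - tau) ->
  101 * h * q <= tau ->
  \sum_(i < n) \sum_(j < n) lt i j <= 1.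
Proof.
move=> flat htau.
have pt (i j : 'I_n) : lt i j <= (if i == j :> nat then (1 - tau) * ((al i + be i) / 2) else 0)
   + h * ((if i == j :> nat then 0 else q ^+ ndist i j) * (al i * be j) `^ s).
  have [ij|ij] := eqVneq (i : nat) (j : nat).
    rewrite -ij mul0r mulr0 addr0 /local_term eqxx mulr1 ndistnn expr0 divr1.
    (* The power [1/2] of [al * be] is averaged, with diagonal total at most [1]; the surplus power
       [s - 1/2] goes into the factor [1 - tau], and this gain pays for the off-diagonal classes. *)
    have se : s = (s - 1 / 2) + 1 / 2 by ring.
    rewrite {2}se powRD; last by rewrite -se (negPf s0).
    rewrite mulrA; apply: ler_pM; rewrite ?powR_ge0 ?mulr_ge0 ?powR_ge0 ?flat//.
    by apply: powR_mean => //; rewrite ?al_ge0 ?be_ge0 ?(sum1_le1 al_ge0 al_sum) ?(sum1_le1 be_ge0 be_sum).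
  by rewrite add0r; have := local_term_off_le ij; rewrite (negPf ij).
apply: le_trans (ler_sum _ (fun i _ => ler_sum _ (fun j _ => pt i j))) _.
under eq_bigr do rewrite big_split/= -mulr_sumr.
rewrite big_split/= -mulr_sumr (sum_diag (fun i => (1 - tau) * ((al i + be i) / 2))).
rewrite -mulr_sumr -mulr_suml big_split/= al_sum be_sum.
have := kernel_off al_ge0 be_ge0; rewrite al_sum be_sum mulr1 powR1 mulr1 => k.
have : h * \sum_(i < n) \sum_(j < n) (if i == j :> nat then 0 else q ^+ ndist i j) * (al i * be j) `^ s <= h * (101 * q) by rewrite ler_wpM2l.
wlra.
Qed.

Section Concentrated.
Variable k : nat.
Hypothesis k_n : (k < n)%N.

Let al' (i : nat) := if i == k then 0 else al i.
Let be' (i : nat) := if i == k then 0 else be i.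
Let ald (i : nat) := if i == k then al i else 0.
Let bed (i : nat) := if i == k then be i else 0.
Let x := 1 - al k.
Let y := 1 - be k.

Let al'0 i : 0 <= al' i. Proof. by rewrite /al'; case: eqP. Qed.
Let be'0 i : 0 <= be' i. Proof. by rewrite /be'; case: eqP. Qed.
Let ald0 i : 0 <= ald i. Proof. by rewrite /ald; case: eqP. Qed.
Let bed0 i : 0 <= bed i. Proof. by rewrite /bed; case: eqP. Qed.
Let x0 : 0 <= x. Proof. by rewrite subr_ge0 (sum1_le1 al_ge0 al_sum). Qed.
Let y0 : 0 <= y. Proof. by rewrite subr_ge0 (sum1_le1 be_ge0 be_sum). Qed.

Lemma sum_ald : \sum_(i < n) ald i = al k.
Proof.
rewrite (bigD1 (Ordinal k_n))//= /ald eqxx big1 ?addr0// => i.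
by rewrite -(inj_eq val_inj)/= => /negPf ->.
Qed.

Lemma sum_bed : \sum_(i < n) bed i = be k.
Proof.
rewrite (bigD1 (Ordinal k_n))//= /bed eqxx big1 ?addr0// => i.
by rewrite -(inj_eq val_inj)/= => /negPf ->.
Qed.

Lemma sum_al' : \sum_(i < n) al' i = x.
Proof.
have e i : al i = ald i + al' i by rewrite /ald /al'; case: eqP; rewrite ?addr0 ?add0r.
rewrite /x -al_sum (eq_bigr _ (fun (i : 'I_n) _ => e i)) big_split/= sum_ald.
by rewrite addrAC subrr add0r.
Qed.

Lemma sum_be' : \sum_(i < n) be' i = y.
Proof.
have e i : be i = bed i + be' i by rewrite /bed /be'; case: eqP; rewrite ?addr0 ?add0r.
rewrite /y -be_sum (eq_bigr _ (fun (i : 'I_n) _ => e i)) big_split/= sum_bed.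
by rewrite addrAC subrr add0r.
Qed.

(* The exponent [k] dominates, but the mass off [k] is well above [1/P]: the drop
   of the term [(k, k)] outweighs all the other terms. *)
Lemma local_spread z : 0 < z -> z <= 1 -> 1 - al k <= z -> 1 - be k <= z ->
  al k * be k <= 1 - z ->
  100 * h * z `^ (2 * s - 1) <= 1 / 4 ->
  202 * h * (P * z) `^ (- (1 - s)) <= 1 / 4 ->
  \sum_(i < n) \sum_(j < n) lt i j <= 1.
Proof.
move=> z0 z1 xz yz abz h1 h2.
pose w0 (i j : nat) := if i == j then 0 else q ^+ ndist i j.
have w0_ge0 i j : 0 <= w0 i j by rewrite /w0; case: eqP => // _; rewrite exprn_ge0.
pose F (i : nat) := if i == k then (al k * be k) `^ s else 0.
(* A pair is [(k, k)], or lies in row [k] or in column [k], or avoids [k]; one summand bounds each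
   case and the others are nonnegative. *)
have pt (i j : 'I_n) : lt i j <= (if i == j :> nat then F i else 0)
   + h * (w0 i j * (ald i * be' j) `^ s) + h * (w0 i j * (al' i * bed j) `^ s)
   + h * (q ^+ ndist i j * (al' i * be' j) `^ s).
  have n1 u v : 0 <= h * (w0 i j * (u * v) `^ s) by rewrite !mulr_ge0// powR_ge0.
  have n2 u v : 0 <= h * (q ^+ ndist i j * (u * v) `^ s).
    by rewrite !mulr_ge0 ?exprn_ge0// powR_ge0.
  have n3 : 0 <= (if i == j :> nat then F i else 0).
    by rewrite /F; do 2![case: eqP => // _]; exact: powR_ge0.
  have p1 := n1 (ald i) (be' j); have p2 := n1 (al' i) (bed j); have p3 := n2 (al' i) (be' j).
  have [ik|ik] := eqVneq (i : nat) k; have [jk|jk] := eqVneq (j : nat) k.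
  - have ltle : lt i j <= (if i == j :> nat then F i else 0).
      by rewrite ik jk eqxx /F eqxx local_term_diag_le.
    wlra.
  - have ij : (i : nat) != j by rewrite ik eq_sym.
    have := local_term_off_le ij; rewrite -/(w0 i j).
    have -> : al i = ald i by rewrite /ald ik eqxx.
    have -> : be j = be' j by rewrite /be' (negPf jk).
    wlra.
  - have ij : (i : nat) != j by rewrite jk.
    have := local_term_off_le ij; rewrite -/(w0 i j).
    have -> : al i = al' i by rewrite /al' (negPf ik).
    have -> : be j = bed j by rewrite /bed jk eqxx.
    wlra.
  - have := local_term_le i j.
    have -> : al i = al' i by rewrite /al' (negPf ik).
    have -> : be j = be' j by rewrite /be' (negPf jk).
    wlra.
apply: le_trans (ler_sum _ (fun i _ => ler_sum _ (fun j _ => pt i j))) _.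
under eq_bigr do rewrite 3!big_split/= -!mulr_sumr.
rewrite 3!big_split/= -!mulr_sumr sum_diag.
have -> : \sum_(i < n) F i = (al k * be k) `^ s.
  rewrite (bigD1 (Ordinal k_n))//= /F eqxx big1 ?addr0// => i.
  by rewrite -(inj_eq val_inj)/= => /negPf ->.
have k1 := kernel_off ald0 be'0; have k2 := kernel_off al'0 bed0.
have k3 := kernel_all al'0 be'0.
rewrite sum_ald sum_be' in k1; rewrite sum_al' sum_bed in k2.
rewrite sum_al' sum_be' in k3.
(* Each error is written as [z] times a small number, to be compared with the gain [s * z >= z / 2]
   on the class [(k, k)]: row and column [k] together use [z / 4], the rest another [z / 4]. *)
have zs : q * z `^ s = z * (P * z) `^ (- (1 - s)).
  rewrite powRM ?ltW// mulrCA; congr (_ * _).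
  have {1}-> : s = 1 + - (1 - s) by ring.
  by rewrite powRDpos// powRr1 ?ltW.
have zs2 : z `^ (2 * s) = z * z `^ (2 * s - 1).
  have e : 2 * s = 1 + (2 * s - 1) by ring.
  by rewrite {1}e powRDpos// powRr1 ?ltW.
have b1 : (al k * y) `^ s <= z `^ s.
  apply: le_powR; rewrite ?mulr_ge0//; first by wlra.
  by apply: le_trans yz; rewrite ler_piMl// (sum1_le1 al_ge0 al_sum).
have b2 : (x * be k) `^ s <= z `^ s.
  apply: le_powR; rewrite ?mulr_ge0//; first by wlra.
  by apply: le_trans xz; rewrite ler_piMr// (sum1_le1 be_ge0 be_sum).
have b3 : (x * y) `^ s <= z `^ (2 * s).
  rewrite powRrM powR_mulrn ?(ltW z0)// expr2.
  by apply: le_powR; rewrite ?mulr_ge0//; [wlra|exact: ler_pM].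
have b0 : (al k * be k) `^ s <= 1 - s * z.
  apply: le_trans (powR_bernoulli s01 _); last by rewrite ltW.
  by apply: le_powR; rewrite ?mulr_ge0//; wlra.
have c1 : h * (101 * q * (al k * y) `^ s) <= 101 * h * (z * (P * z) `^ (- (1 - s))).
  rewrite -zs; have : 0 <= h * (101 * q) by rewrite !mulr_ge0.
  by move=> hq; have := ler_wpM2l hq b1; wlra.
have c2 : h * (101 * q * (x * be k) `^ s) <= 101 * h * (z * (P * z) `^ (- (1 - s))).
  rewrite -zs; have : 0 <= h * (101 * q) by rewrite !mulr_ge0.
  by move=> hq; have := ler_wpM2l hq b2; wlra.
have c3 : h * (100 * (x * y) `^ s) <= 100 * h * (z * z `^ (2 * s - 1)).
  by rewrite -zs2; have := ler_wpM2l h_ge0 b3; wlra.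
have d1 := ler_wpM2l h_ge0 k1; have d2 := ler_wpM2l h_ge0 k2.
have d3 := ler_wpM2l h_ge0 k3.
have e1 : z * (202 * h * (P * z) `^ (- (1 - s))) <= z * (1 / 4) by rewrite ler_pM2l.
have e2 : z * (100 * h * z `^ (2 * s - 1)) <= z * (1 / 4) by rewrite ler_pM2l.
have e3 : z * (1 / 2) <= z * s by rewrite ler_pM2l.
rewrite -/x -/y in k1 k2 k3 *.
wlra.
Qed.

(** Apart from [k + 1], only [j = k - 1] is at distance [1] from [k]. At distance [d >= 2], [P >= 2]
    gives [P^(-d) <= 4 P^(-2) 2^(-d)], and [2^(-d)] sums to at most [2] over [j != k]. *)
Lemma tame_tail (c : nat -> R) (m : R) :
  (forall i, 0 <= c i <= 1) -> 0 <= m -> (forall j, j.+1 = k -> c j <= m) ->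
  \sum_(j < n | ~~ tame_exp k j) c j / P ^+ ndist k j <= m / P + 8 / P ^+ 2.
Proof.
move=> c01 m0 cm.
have Pi : 0 < P^-1 by rewrite invr_gt0.
have Pi2 : P^-1 <= 1 / 2 by rewrite mul1r lef_pV2 ?posrE.
have pt (j : 'I_n) : ~~ tame_exp k j -> c j / P ^+ ndist k j <=
    (if j.+1 == k then m / P else 0) + 4 / P ^+ 2 * (1 / 2) ^+ ndist k j.
  rewrite negb_or => /andP[jk jk1]; have /andP[cj0 cj1] := c01 j.
  have [e|jk2] := eqVneq j.+1 k.
    have -> : ndist k j = 1%N by rewrite -e ndistSn.
    rewrite expr1; apply: (@le_trans _ _ (m / P)).
      by rewrite ler_pM2r// cm.
    by rewrite lerDl mulr_ge0// ?divr_ge0// exprn_ge0// ltW.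
  have := ndist_ge2 jk jk1 jk2.
  case: (ndist k j) => [//|[//|d]] _; rewrite add0r -!exprVn !exprS expr0 mulr1.
  have hd : P^-1 ^+ d <= (1 / 2) ^+ d by rewrite lerXn2r ?nnegrE// ltW.
  have hd0 : 0 <= P^-1 ^+ d by rewrite exprn_ge0// ltW.
  have hP : 0 <= P^-1 * P^-1 by rewrite mulr_ge0// ltW.
  apply: (@le_trans _ _ (P^-1 * (P^-1 * P^-1 ^+ d))).
    by rewrite ler_piMl// !mulr_ge0// ltW.
  by rewrite mulrA; have := ler_wpM2l hP hd; lra.
apply: (le_trans (ler_sum _ pt)).
rewrite big_split/= -mulr_sumr; apply: lerD.
  rewrite (@le_trans _ _ (\sum_(j < n) if j.+1 == k then m / P else 0))//.
    rewrite big_mkcond/=; apply: ler_sum => j _; case: ifP => // _; case: ifP => // _.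
    by rewrite divr_ge0// ltW.
  rewrite -big_mkcond/=.
  have [->|k0] := posnP k; first by rewrite big_pred0// divr_ge0// ltW.
  have kn : (k.-1 < n)%N := leq_ltn_trans (leq_pred k) k_n.
  by rewrite (big_pred1 (Ordinal kn))// => j; rewrite /= succn_eq.
have h12 : (1 / 2 : R) < 1 by lra.
have h12' : (0 : R) <= 1 / 2 by lra.
have := sum_ndist_pos n k h12' h12.
have h21 : (1 - 1 / 2 : R) = 1 / 2 by lra.
rewrite h21 mulfK; last by rewrite mul1r invr_eq0 pnatr_eq0.
move=> hs.
have -> : 8 / P ^+ 2 = 4 / P ^+ 2 * 2 by ring.
rewrite ler_wpM2l ?divr_ge0 ?exprn_ge0 ?(ltW P0)//; apply: le_trans hs.
rewrite big_mkcond [leRHS]big_mkcond/=; apply: ler_sum => j _.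
rewrite /tame_exp negb_or; by case: (eqVneq (j : nat) k) => //= _; case: ifP => // _; rewrite exprn_ge0.
Qed.

(** The price [h] equals [H^(1 - s)], so it moves inside the power before Young's inequality; this
    explains the exponent [(1 - s)^-1] in [H]. *)
Lemma tame_young (c ga : nat -> R) j : 0 <= c j -> 0 <= ga j ->
  (c j / P ^+ ndist k j) `^ (1 - s) * ga j `^ s * h <=
  s * ga j + (1 - s) * H * (c j / P ^+ ndist k j).
Proof.
move=> c0 g0; have d0 : 0 <= c j / P ^+ ndist k j by rewrite divr_ge0// exprn_ge0// ltW.
have H0 : 0 <= H by exact: powR_ge0.
have -> : h = H `^ (1 - s).
  by rewrite /H -powRrM mulVf ?powRr1//; rewrite gt_eqF//; wlra.
rewrite mulrAC -powRM// mulrC [_ * H]mulrC -mulrA.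
by apply: powR_young => //; rewrite mulr_ge0.
Qed.

(* [am] and [bm] stand for the weights at [k - 1]; Young's inequality trades the
   classes next to [(k, k)] against the mass they take away from it. *)
Lemma local_tame am bm tau sg :
  0 <= am <= 1 -> 0 <= bm <= 1 -> 0 <= tau <= 1 -> P^-1 <= sg ->
  (forall j, j.+1 = k -> a j <= am) -> (forall j, j.+1 = k -> b j <= bm) ->
  1 - al k <= sg -> 1 - be k <= sg ->
  0 <= 1 - am / P + 10 * tau / P -> 0 <= 1 - bm / P + 10 * tau / P ->
  \sum_(i < n) \sum_(j < n) (if tame_pair k i j then 0 else lt i j) +
  ((1 - am / P + 10 * tau / P) * (1 - bm / P + 10 * tau / P)) `^ (1 - s) *
  ((\sum_(i < n | tame_exp k i) al i) * (\sum_(i < n | tame_exp k i) be i)) `^ s <=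
  1 + 2 * (1 - s) * (H - 1) / P +
    (20 * tau / P + 121 * sg ^+ 2 + 16 * H / P ^+ 2 + 100 * h * sg `^ (2 * s)).
Proof.
move=> /andP[am0 am1] /andP[bm0 bm1] /andP[t0 t1] Psg ha hb xsg ysg A0 B0.
set A := 1 - am / P + 10 * tau / P; set B := 1 - bm / P + 10 * tau / P.
have Pi : 0 < P^-1 by rewrite invr_gt0.
have sg0 : 0 < sg by apply: lt_le_trans Psg.
have H1 : 1 <= H by apply: powR_ge1 => //; rewrite invr_ge0; wlra.
pose xs := \sum_(i < n | ~~ tame_exp k i) al i.
pose ys := \sum_(i < n | ~~ tame_exp k i) be i.
have xs0 : 0 <= xs by rewrite sumr_ge0.
have ys0 : 0 <= ys by rewrite sumr_ge0.
have alS : \sum_(i < n | tame_exp k i) al i = 1 - xs.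
  by rewrite -al_sum [in RHS](bigID (fun i : 'I_n => tame_exp k i))/= addrK.
have beS : \sum_(i < n | tame_exp k i) be i = 1 - ys.
  by rewrite -be_sum [in RHS](bigID (fun i : 'I_n => tame_exp k i))/= addrK.
have xsx : xs <= x.
  rewrite -sum_al' /xs big_mkcond/=; apply: ler_sum => i _; rewrite /al' /tame_exp.
  by case: eqP => //= _; case: eqP.
have ysy : ys <= y.
  rewrite -sum_be' /ys big_mkcond/=; apply: ler_sum => i _; rewrite /be' /tame_exp.
  by case: eqP => //= _; case: eqP.
have xs1 : xs <= 1 by apply: le_trans xsx _; rewrite /x lerBlDr lerDl.
have ys1 : ys <= 1 by apply: le_trans ysy _; rewrite /y lerBlDr lerDl.
(* [G1] bounds the non-tame classes in row [k] and [G2] those in column [k], after weight and mass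
   at [k] itself are estimated by [1]. *)
pose G1 (j : nat) := if tame_exp k j then 0 else s * be j + (1 - s) * H * (b j / P ^+ ndist k j).
pose G2 (j : nat) := if tame_exp k j then 0 else s * al j + (1 - s) * H * (a j / P ^+ ndist k j).
have s0' : 0 <= s by wlra.
have s1' : 0 <= 1 - s by wlra.
have G10 j : 0 <= G1 j.
  rewrite /G1; case: ifP => // _; have /andP[b0 _] := b01 j.
  by rewrite addr_ge0 ?mulr_ge0 ?invr_ge0 ?exprn_ge0 ?(ltW P0)//; lra.
have G20 j : 0 <= G2 j.
  rewrite /G2; case: ifP => // _; have /andP[a0 _] := a01 j.
  by rewrite addr_ge0 ?mulr_ge0 ?invr_ge0 ?exprn_ge0 ?(ltW P0)//; lra.
have pt (i j : 'I_n) : (if tame_pair k i j then 0 else lt i j) <=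
   (if i == k :> nat then G1 j else 0) + (if j == k :> nat then G2 i else 0)
   + h * (q ^+ ndist i j * (al' i * be' j) `^ s).
  have n2 : 0 <= h * (q ^+ ndist i j * (al' i * be' j) `^ s).
    by rewrite !mulr_ge0 ?exprn_ge0// powR_ge0.
  have n3 : 0 <= (if i == k :> nat then G1 j else 0) by case: ifP.
  have n4 : 0 <= (if j == k :> nat then G2 i else 0) by case: ifP.
  case: ifP => [_|/negbT tz]; first by rewrite !addr_ge0.
  have /andP[ai0 ai1] := a01 i; have /andP[bj0 bj1] := b01 j.
  have ali1 := sum1_le1 al_ge0 al_sum (ltn_ord i); have bej1 := sum1_le1 be_ge0 be_sum (ltn_ord j).
  have iP d : 0 <= (P ^+ d)^-1 by rewrite invr_ge0 exprn_ge0// ltW.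
  have [ik|ik] := eqVneq (i : nat) k.
    have jS : ~~ tame_exp k j by move: tz; rewrite /tame_pair /tame_exp ik eqxx/= andbT.
    have lG : lt i j <= G1 j.
      rewrite /G1 (negPf jS); apply: le_trans (tame_young _ _) => //.
      rewrite /local_term ik; apply: ler_pM; rewrite ?mulr_ge0 ?powR_ge0//.
        by case: ifP => // _.
        apply: ler_pM; rewrite ?powR_ge0//.
          apply: le_powR; rewrite ?mulr_ge0// -ik//.
          by rewrite ler_wpM2r// ler_piMl.
        by apply: le_powR; rewrite ?mulr_ge0// -ik ler_piMl.
      by case: ifP.
    by rewrite -addrA (le_trans lG)// lerDl addr_ge0.
  have [jk|jk] := eqVneq (j : nat) k.
    have iS : ~~ tame_exp k i by move: tz; rewrite /tame_pair /tame_exp jk eqxx/= orbT andbT.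
    have lG : lt i j <= G2 i.
      rewrite /G2 (negPf iS); apply: le_trans (tame_young _ _) => //.
      rewrite /local_term jk ndistC; apply: ler_pM; rewrite ?mulr_ge0 ?powR_ge0//.
        by case: ifP => // _.
        apply: ler_pM; rewrite ?powR_ge0//.
          apply: le_powR; rewrite ?mulr_ge0// -jk//.
          by rewrite ler_wpM2r// ler_piMr.
        by apply: le_powR; rewrite ?mulr_ge0// -jk ler_piMr.
      by case: ifP.
    by rewrite add0r (le_trans lG)// lerDl.
  have := local_term_le i j.
  have -> : al i = al' i by rewrite /al' (negPf ik).
  have -> : be j = be' j by rewrite /be' (negPf jk).
  lra.
have sumk (G : nat -> R) : \sum_(i < n) (if i == k :> nat then G i else 0) = G k.
  rewrite (bigD1 (Ordinal k_n))//= eqxx big1 ?addr0// => i.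
  by rewrite -(inj_eq val_inj)/= => /negPf ->.
have S1 : \sum_(j < n) G1 j = s * ys + (1 - s) * H * \sum_(j < n | ~~ tame_exp k j) b j / P ^+ ndist k j.
  rewrite /ys !mulr_sumr -big_split/= [RHS]big_mkcond/=; apply: eq_bigr => j _.
  by rewrite /G1; case: ifP.
have S2 : \sum_(j < n) G2 j = s * xs + (1 - s) * H * \sum_(j < n | ~~ tame_exp k j) a j / P ^+ ndist k j.
  rewrite /xs !mulr_sumr -big_split/= [RHS]big_mkcond/=; apply: eq_bigr => j _.
  by rewrite /G2; case: ifP.
have T1 := tame_tail b01 bm0 hb; have T2 := tame_tail a01 am0 ha.
have k3 := kernel_all al'0 be'0; rewrite sum_al' sum_be' in k3.
have b3 : (x * y) `^ s <= sg `^ (2 * s).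
  rewrite powRrM powR_mulrn ?(ltW sg0)// expr2.
  by apply: le_powR; rewrite ?mulr_ge0//; exact: ler_pM.
have tot : \sum_(i < n) \sum_(j < n) (if tame_pair k i j then 0 else lt i j) <=
  \sum_(j < n) G1 j + \sum_(j < n) G2 j + h * (100 * sg `^ (2 * s)).
  apply: le_trans (ler_sum _ (fun i _ => ler_sum _ (fun j _ => pt i j))) _.
  under eq_bigr do rewrite 2!big_split/= -!mulr_sumr.
  rewrite 2!big_split/= -!mulr_sumr; apply: lerD; last first.
    by rewrite ler_wpM2l//; apply: le_trans k3 _; rewrite ler_wpM2l.
  apply: lerD.
    rewrite exchange_big/= le_eqVlt; apply/orP; left; apply/eqP.
    by apply: eq_bigr => j _; rewrite (sumk (fun=> G1 j)).
  rewrite le_eqVlt; apply/orP; left; apply/eqP.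
  by apply: eq_bigr => i _; rewrite (sumk (fun=> G2 i)).
(* First-order losses of the tame block. In [u], the term [s * xs] pays for the same term in the sum
   of [G2], and [(1 - s) * am / P] pays for all but [H - 1] times itself; likewise [v] and [G1]. At
   most [2 (1 - s) (H - 1) / P] is left to first order, and [u * v] is of second order. *)
pose u := s * xs + (1 - s) * (am / P - 10 * tau / P).
pose v := s * ys + (1 - s) * (bm / P - 10 * tau / P).
have mA : A `^ (1 - s) * (1 - xs) `^ s <= 1 - u.
  rewrite mulrC; apply: le_trans (powR_young s01 _ _) _ => //; first by rewrite subr_ge0.
  by rewrite /u /A; lra.
have mB : B `^ (1 - s) * (1 - ys) `^ s <= 1 - v.
  rewrite mulrC; apply: le_trans (powR_young s01 _ _) _ => //; first by rewrite subr_ge0.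
  by rewrite /v /B; lra.
have main : (A * B) `^ (1 - s) * ((1 - xs) * (1 - ys)) `^ s <= (1 - u) * (1 - v).
  rewrite !powRM ?subr_ge0//.
  have -> : A `^ (1 - s) * B `^ (1 - s) * ((1 - xs) `^ s * (1 - ys) `^ s) =
   (A `^ (1 - s) * (1 - xs) `^ s) * (B `^ (1 - s) * (1 - ys) `^ s) by ring.
  by apply: ler_pM; rewrite ?mulr_ge0 ?powR_ge0.
(* One [sg] comes from the mass and ten from the weight; the square of [11] is the constant
   [121]. *)
have bnd (e r : R) : 0 <= e <= sg -> 0 <= r <= 1 ->
    `|s * e + (1 - s) * (r / P - 10 * tau / P)| <= 11 * sg.
  move=> /andP[e0 e1] /andP[r0 r1].
  have g1 : 0 <= r / P by rewrite divr_ge0// ltW.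
  have g2 : r / P <= sg by apply: le_trans Psg; rewrite ler_piMl// ltW.
  have g3 : 0 <= tau / P by rewrite divr_ge0// ltW.
  have g4 : tau / P <= sg by apply: le_trans Psg; rewrite ler_piMl// ltW.
  have g5 : s * e <= 1 * e by rewrite ler_wpM2r//; wlra.
  have g6 : 0 <= s * e by rewrite mulr_ge0.
  have g7 : `|(1 - s) * (r / P - 10 * tau / P)| <= 10 * sg.
    rewrite normrM (ger0_norm s1').
    have : `|r / P - 10 * tau / P| <= 10 * sg by rewrite ler_norml; apply/andP; split; lra.
    have s11 : 1 - s <= 1 by wlra.
    by move=> g; have := ler_pM s1' (normr_ge0 _) s11 g; rewrite mul1r.
  by apply: le_trans (ler_normD _ _) _; rewrite (ger0_norm g6); lra.
have ub : `|u| <= 11 * sg by apply: bnd; rewrite ?xs0 ?am0//= (le_trans xsx).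
have vb : `|v| <= 11 * sg by apply: bnd; rewrite ?ys0 ?bm0//= (le_trans ysy).
have uv : u * v <= 121 * sg ^+ 2.
  apply: le_trans (ler_norm _) _; rewrite normrM.
  have := ler_pM (normr_ge0 _) (normr_ge0 _) ub vb.
  by rewrite expr2; lra.
rewrite alS beS.
have sH : 0 <= (1 - s) * H by rewrite mulr_ge0//; lra.
have T1' := ler_wpM2l sH T1; have T2' := ler_wpM2l sH T2.
have sHP : (1 - s) * H * (8 / P ^+ 2) <= 8 * H / P ^+ 2.
  have g : 0 <= 8 * H / P ^+ 2 by rewrite mulr_ge0 ?invr_ge0 ?exprn_ge0 ?(ltW P0)//; lra.
  have s11 : 1 - s <= 1 by wlra.
  by have := ler_wpM2r g s11; lra.
have hm (m : R) : 0 <= m <= 1 -> (1 - s) * (H - 1) * (m / P) <= (1 - s) * (H - 1) / P.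
  move=> /andP[m0 m1]; rewrite mulrA ler_pM2r// ler_piMr// mulr_ge0//; lra.
have hm1 := hm am; have hm2 := hm bm.
rewrite am0 am1 in hm1; rewrite bm0 bm1 in hm2.
have := hm1 isT; have := hm2 isT.
have tp : 0 <= tau / P by rewrite divr_ge0// ltW.
have stp : 0 <= s * (tau / P) by rewrite mulr_ge0.
move: tot; rewrite S1 S2 /u /v in main uv * => tot.
move=> z1 z2.
lra.
Qed.

End Concentrated.

End Weights.
End LocalFactor.

(** * The three regimes at a large prime *)

Section LocalLarge.
Variable R : realType.
Implicit Types (s h P tau z : R) (a b al be : nat -> R).

Local Ltac clra := clear; lra.

Lemma powR_mul_gt (r u v tau : R) : 0 < r < 1 -> 0 <= u <= 1 -> 0 <= v <= 1 ->
  1 - tau < u `^ r * v -> r * (1 - u) <= tau.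
Proof.
move=> r01 /andP[u0 u1] /andP[v0 v1] huv.
have h1 : u `^ r * v <= u `^ r by rewrite ler_piMr// powR_ge0.
have := @powR_bernoulli R r (1 - u) r01; rewrite subKr => h2.
have : u `^ r <= 1 - r * (1 - u) by apply: h2; rewrite subr_ge0 u1/= lerBlDr lerDl.
by move: huv h1; clra.
Qed.

(** All four factors lie in [[0, 1]], so a product above [1 - tau] forces each of them above
    [1 - tau]; Bernoulli's inequality passes from the powers to their bases. *)
Lemma concentration_loss (s a b x y e tau : R) : 1 / 2 < s -> s <= 9 / 10 ->
  0 < e < 1 -> 0 <= a <= 1 -> 0 <= b <= 1 -> 0 <= x <= 1 -> 0 <= y <= 1 ->
  1 - tau < (a * b) `^ (1 - s) * (x * y) `^ e ->
  [/\ (1 - s) * (1 - a) <= tau, (1 - s) * (1 - b) <= tau,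
      e * (1 - x) <= tau & e * (1 - y) <= tau].
Proof.
move=> s_gt s_le e01 a01 b01 x01 y01.
have s1 : 0 < 1 - s < 1 by apply/andP; move: (s_gt) (s_le); split; lra.
have pw1 (r u : R) : 0 < r < 1 -> 0 <= u <= 1 -> 0 <= u `^ r <= 1.
  by move=> /andP[r0 _] /andP[u0 u1]; rewrite powR_ge0 powR_le1// ltW.
have m01 (u v : R) : 0 <= u <= 1 -> 0 <= v <= 1 -> 0 <= u * v <= 1.
  by move=> /andP[u0 u1] /andP[v0 v1]; rewrite mulr_ge0//= mulr_ile1.
have A1 := pw1 _ _ s1 a01; have B1 := pw1 _ _ s1 b01.
have X1 := pw1 _ _ e01 x01; have Y1 := pw1 _ _ e01 y01.
have /andP[a0 _] := a01; have /andP[b0 _] := b01.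
have /andP[x0 _] := x01; have /andP[y0 _] := y01.
rewrite !powRM// => conc; split.
- apply: (powR_mul_gt s1 a01 (m01 _ _ B1 (m01 _ _ X1 Y1))).
  by rewrite !mulrA in conc *.
- apply: (powR_mul_gt s1 b01 (m01 _ _ A1 (m01 _ _ X1 Y1))).
  by rewrite mulrCA; rewrite !mulrA in conc *.
- apply: (powR_mul_gt e01 x01 (m01 _ _ Y1 (m01 _ _ A1 B1))).
  by rewrite mulrA mulrC.
- apply: (powR_mul_gt e01 y01 (m01 _ _ X1 (m01 _ _ A1 B1))).
  by rewrite [X in _ < X](_ : _ = a `^ (1 - s) * b `^ (1 - s) * (x `^ e * y `^ e))//; ring.
Qed.

(** The value [0] at [k = 0] reflects that no class lies below the exponent [0]. *)
Definition prev_weight (c : nat -> R) (k : nat) : R :=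
  if k is k'.+1 then c k' else 0.

Lemma prev_weight01 c k : (forall i, 0 <= c i <= 1) -> 0 <= prev_weight c k <= 1.
Proof. by move=> c01; case: k => [|k] /=; rewrite ?c01 ?lexx ?ler01. Qed.

(** At [k] this follows from [c_k + c_(k-1) / P <= 1]. At [k + 1] the same relation involves [c_k]
    instead of [c_(k-1)], and [c_k >= 1 - 10 tau >= c_(k-1) - 10 tau] allows the exchange. *)
Lemma tame_weight_le c k P tau : 0 < P -> 0 <= tau ->
  (forall i, 0 <= c i <= 1) -> (forall i, c i.+1 + c i / P <= 1) ->
  1 - c k <= 10 * tau ->
  forall i, tame_exp k i -> c i <= 1 - prev_weight c k / P + 10 * tau / P.
Proof.
move=> P0 tau0 c01 cS ck i; have Pi : 0 < P^-1 by rewrite invr_gt0.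
have tP : 0 <= 10 * tau / P by rewrite divr_ge0// ?(ltW P0)// mulr_ge0.
move=> /orP[/eqP ->|/eqP ->].
  have : c k + prev_weight c k / P <= 1.
    case: k {ck} => [|k']/=; last exact: cS.
    by rewrite mul0r addr0; have /andP[] := c01 0%N.
  by move: tP; clra.
have /andP[_ p1] := prev_weight01 k c01.
have := cS k; have : prev_weight c k - 10 * tau <= c k by move: ck p1; clra.
by rewrite -(ler_pM2r Pi) mulrBl; clra.
Qed.

Lemma spread_small h tau (e : R) z : 1 <= h -> 0 < e ->
  0 <= tau -> 0 <= z -> z <= tau / e ->
  tau `^ (2 * e) <= e `^ (2 * e) / (400 * h) ->
  100 * h * z `^ (2 * e) <= 1 / 4.
Proof.
move=> h1 e0 tau0 z0 ze t2; have h0 : 0 < 400 * h by move: h1; clra.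
have zz : z `^ (2 * e) <= (400 * h)^-1.
  apply: (@le_trans _ _ ((tau / e) `^ (2 * e))).
    by apply: le_powR => //; rewrite mulr_ge0// ltW.
  rewrite powRM ?invr_ge0 ?(ltW e0)// -[e^-1]powR_inv1 ?(ltW e0)// -powRrM mulN1r powRN.
  by rewrite ler_pdivrMr ?powR_gt0// [_ * e `^ _]mulrC.
have := zz; rewrite -[(400 * h)^-1]mul1r ler_pdivlMr//.
by clra.
Qed.

Lemma spread_large s h P (e : R) z : s <= 9 / 10 -> 1 <= h -> 0 < P -> 0 < e ->
  P `^ (- 1 + e / 2) < z -> P `^ (- (e * (1 - s) / 2)) <= (808 * h)^-1 ->
  202 * h * (P * z) `^ (- (1 - s)) <= 1 / 4.
Proof.
move=> s_le h1 P0 e0 zsg t3; have h0 : 0 < 808 * h by move: h1; clra.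
have z0 : 0 < z by apply: le_lt_trans zsg; exact: powR_ge0.
have pz : (P * z) `^ (- (1 - s)) <= (808 * h)^-1.
  apply: le_trans t3; rewrite (_ : - (e * (1 - s) / 2) = e / 2 * (- (1 - s))); last by ring.
  rewrite powRrM !powRN lef_pV2 ?posrE ?powR_gt0 ?mulr_gt0//.
  apply: le_powR; rewrite ?powR_ge0//; first by move: (s_le); clra.
  have -> : e / 2 = 1 + (- 1 + e / 2) by ring.
  by rewrite powRDpos// powRr1 ?(ltW P0)// ler_pM2l// ltW.
have := pz; rewrite -[(808 * h)^-1]mul1r ler_pdivlMr//.
by clra.
Qed.

(** The threshold [P^(-1 + e/2)] for the mass off [k] is low enough that its square and its power
    [2 s] stay below [P^(-1 - e/8)]; in [spread_large] it is high enough to make [(P z)^(-(1 - s))]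
    small. *)
Lemma tame_error_le s h (H : R) P (e : R) : 1 <= h -> 0 <= H -> 1 <= P -> s = e + 1 / 2 ->
  0 < e -> e <= 2 / 5 ->
  20 * P `^ (- (e / 8)) / P + 121 * (P `^ (- 1 + e / 2)) ^+ 2 + 16 * H / P ^+ 2 +
    100 * h * (P `^ (- 1 + e / 2)) `^ (2 * s) <=
  (20 + 121 + 16 * H + 100 * h) * P `^ (- (1 + e / 8)).
Proof.
move=> h1 H0 P1 se e0 e1; set N := P `^ (- (1 + _)).
have P0 : 0 < P by move: P1; clra.
have ler_N r : r <= - (1 + e / 8) -> P `^ r <= N by move=> hr; apply: ler_powR.
have c1 : P `^ (- (e / 8)) / P <= N.
  rewrite -[P^-1]powR_inv1 ?(ltW P0)// -powRDpos//; apply: ler_N; clra.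
have c2 : (P `^ (- 1 + e / 2)) ^+ 2 <= N.
  by rewrite -powR_mulrn ?powR_ge0// -powRrM; apply: ler_N; move: e1; clra.
have c3 : (P ^+ 2)^-1 <= N.
  by rewrite -powR_mulrn ?(ltW P0)// -powRN; apply: ler_N; move: e1; clra.
have c4 : (P `^ (- 1 + e / 2)) `^ (2 * s) <= N.
  by rewrite -powRrM; apply: ler_N; rewrite se; move: e0 e1; clear; nra.
have h0 : 0 <= h by move: h1; clra.
by have := ler_wpM2l H0 c3; have := ler_wpM2l h0 c4; move: c1 c2; clra.
Qed.

(** With [tau = P^(-d)], either all diagonal weights are at most [1 - tau], or some [k] carries
    almost everything and the mass off [k] lies above or below [P^(-1 + e/2)]. Since [P1] and [kap]
    depend on [s] and [h] only, they serve all primes and functions at once. *)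
Lemma local_large s h : 1 / 2 < s -> s <= 9 / 10 -> 1 <= h -> exists P1 kap : R, 0 < kap /\
  forall P n a b al be, P1 <= P -> 2 <= P ->
  (forall i, 0 <= a i <= 1) -> (forall i, 0 <= b i <= 1) ->
  (forall i, a i.+1 + a i / P <= 1) -> (forall i, b i.+1 + b i / P <= 1) ->
  (forall i, 0 <= al i) -> (forall i, 0 <= be i) ->
  \sum_(i < n) al i = 1 -> \sum_(i < n) be i = 1 ->
  \sum_(i < n) \sum_(j < n) local_term s h P a b al be i j <= 1 \/
  exists k (A B : R), [/\ (0 <= A) && (0 <= B), forall i, tame_exp k i -> a i <= A,
    forall i, tame_exp k i -> b i <= B &
    \sum_(i < n) \sum_(j < n) (if tame_pair k i j then 0
                                 else local_term s h P a b al be i j) +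
    (A * B) `^ (1 - s) *
    ((\sum_(i < n | tame_exp k i) al i) * (\sum_(i < n | tame_exp k i) be i)) `^ s <=
    1 + 2 * (1 - s) * (h `^ (1 - s)^-1 - 1) / P +
    kap * P `^ (- (1 + (s - 1 / 2) / 8))].
Proof.
move=> s_gt s_le h1.
set H := h `^ _; have H0 : 0 <= H by exact: powR_ge0.
pose e := s - 1 / 2; pose d := e / 8.
have se : s = e + 1 / 2 by rewrite /e; ring.
have e0 : 0 < e by rewrite /e; move: (s_gt); clra.
have e1 : e <= 2 / 5 by rewrite /e; move: (s_le); clra.
have d0 : 0 < d by rewrite /d divr_gt0.
have h0 : 0 < h by move: h1; clra.
have h101 : 0 < (101 * h)^-1 by rewrite invr_gt0; move: h0; clra.
(* [T1] serves the flat case, [T2] and [T3] the two conditions of the spread case, and [T4] gives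
   [tau <= e], hence [z <= 1]. *)
have [T1 [_ t1]] := powR_small d0 h101.
have ed0 : 0 < d * (2 * e) by rewrite !mulr_gt0.
have h400 : 0 < 400 * h by move: h0; clra.
have eh0 : 0 < e `^ (2 * e) / (400 * h) := divr_gt0 (powR_gt0 _ e0) h400.
have [T2 [_ t2]] := powR_small ed0 eh0.
have s1p : 0 < 1 - s by move: (s_le); clra.
have es0 : 0 < e * (1 - s) / 2 by rewrite divr_gt0// mulr_gt0.
have h808 : 0 < (808 * h)^-1 by rewrite invr_gt0; move: h0; clra.
have [T3 [_ t3]] := powR_small es0 h808.
have [T4 [_ t4]] := powR_small d0 e0.
exists (Num.max (Num.max T1 T2) (Num.max T3 T4)), (20 + 121 + 16 * H + 100 * h).
split; first by move: H0 h0; clra.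
move=> P n a b al be; rewrite !ge_max => /andP[/andP[/t1 {}t1 /t2 {}t2] /andP[/t3 {}t3 /t4 {}t4]].
move=> P2 a01 b01 aS bS al0 be0 als bes.
have P0 : 0 < P by move: P2; clra.
have P1 : 1 <= P by move: P2; clra.
pose tau := P `^ (- d).
have tau0 : 0 <= tau by exact: powR_ge0.
rewrite -/tau in t1 t4.
have tau1 : tau <= 1 by apply: le_trans t4 _; move: e1; clra.
have [flat|] := pselect (forall i, (i < n)%N ->
     (a i * b i) `^ (1 - s) * (al i * be i) `^ (s - 1 / 2) <= 1 - tau).
  left; apply: (local_flat s_gt s_le h1 P2 a01 b01 al0 be0 als bes flat).
  (* Here [2 d = e / 4 <= 1/10 <= 1 - s]; one of the two factors [tau] then absorbs [101 * h]. *)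
  have q2 : P `^ (- (1 - s)) <= tau * tau.
    rewrite /tau -powRDpos//; apply: ler_powR => //; rewrite /d /e.
    by move: (s_le); clra.
  have th : tau * (101 * h) <= 1 by rewrite -ler_pdivlMr ?mul1r//; move: h0; clra.
  have := ler_wpM2r tau0 th; rewrite mul1r; apply: le_trans.
  have hh : 0 <= 101 * h by move: h0; clra.
  by rewrite [leRHS]mulrAC [leRHS]mulrC; exact: ler_wpM2l.
move=> /existsNP[k /not_implyP[k_n /negP]]; rewrite -ltNge => conc.
have /andP[ak0 ak1] := a01 k; have /andP[bk0 bk1] := b01 k.
have alk0 := al0 k; have bek0 := be0 k.
have alk1 : al k <= 1 := sum1_le1 al0 als k_n.
have bek1 : be k <= 1 := sum1_le1 be0 bes k_n.
have e01 : 0 < e < 1 by rewrite e0/=; move: e1; clra.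
have alk01 : 0 <= al k <= 1 by rewrite alk0.
have bek01 : 0 <= be k <= 1 by rewrite bek0.
have [ca cb cx cy] := concentration_loss s_gt s_le e01 (a01 k) (b01 k) alk01 bek01 conc.
(* The [10] in [10 * tau] is the bound for [(1 - s)^-1]. *)
have tauS (u : R) : 0 <= u -> (1 - s) * u <= tau -> u <= 10 * tau.
  move=> u0; have : 1 / 10 * u <= (1 - s) * u by rewrite ler_wpM2r//; move: (s_le); clra.
  by clra.
have ca' : 1 - a k <= 10 * tau by apply: tauS; rewrite ?subr_ge0.
have cb' : 1 - b k <= 10 * tau by apply: tauS; rewrite ?subr_ge0.
pose z := Num.max (1 - al k) (1 - be k).
have xz : 1 - al k <= z by rewrite le_max lexx.
have yz : 1 - be k <= z by rewrite le_max lexx orbT.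
have z0 : 0 <= z by apply: le_trans xz; rewrite subr_ge0.
have ze : z <= tau / e by rewrite ge_max !ler_pdivlMr// ![_ * e]mulrC cx cy.
have abz : al k * be k <= 1 - z.
  rewrite lerBrDl -lerBrDr ge_max; apply/andP; split.
    by rewrite lerD2l lerN2 ler_piMr.
  by rewrite lerD2l lerN2 ler_piMl.
pose sg' := P `^ (- 1 + e / 2).
have [zsg|zsg] := ltP sg' z.
  left; have zp : 0 < z by apply: le_lt_trans zsg; exact: powR_ge0.
  have z1 : z <= 1 by apply: le_trans ze _; rewrite ler_pdivrMr// mul1r.
  apply: (local_spread s_gt s_le h1 P2 a01 b01 al0 be0 als bes k_n zp z1 xz yz abz).
    have -> : 2 * s - 1 = 2 * e by rewrite /e; field.
    by apply: (spread_small h1 e0 tau0 z0 ze); rewrite /tau -powRrM mulNr.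
  exact: (spread_large s_le h1 P0 e0 zsg).
right.
have Ale := tame_weight_le P0 tau0 a01 aS ca'.
have Ble := tame_weight_le P0 tau0 b01 bS cb'.
have tk : tame_exp k k by rewrite /tame_exp eqxx.
exists k, (1 - prev_weight a k / P + 10 * tau / P), (1 - prev_weight b k / P + 10 * tau / P).
have A0 := le_trans ak0 (Ale _ tk); have B0 := le_trans bk0 (Ble _ tk).
split=> //; first by rewrite A0.
have Psg : P^-1 <= sg'.
  rewrite -powR_inv1 ?(ltW P0)//; apply: ler_powR => //.
  by rewrite lerDl divr_ge0// ltW.
have tau01 : 0 <= tau <= 1 by rewrite tau0.
have prevP (c : nat -> R) j : j.+1 = k -> c j <= prev_weight c k by move=> <-.
have := local_tame s_gt s_le h1 P2 a01 b01 al0 be0 als bes k_n (prev_weight01 k a01)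
  (prev_weight01 k b01) tau01 Psg (prevP a) (prevP b)
  (le_trans xz zsg) (le_trans yz zsg) A0 B0.
move=> /le_trans; apply; rewrite lerD2l -/H.
exact: tame_error_le.
Qed.

End LocalLarge.

(** * Sums over primes *)

Section PrimeSums.
Variable R : realType.

Lemma sum_uniq_subset (T : eqType) (F : T -> R) (L M : seq T) :
  uniq L -> {subset L <= M} -> (forall x, x \in M -> 0 <= F x) ->
  \sum_(x <- L) F x <= \sum_(x <- M) F x.
Proof.
elim: L M => [|a L IH] M /=.
  by move=> _ _ F0; rewrite big_nil big_seq sumr_ge0.
move=> /andP[aL uL] LM F0.
have aM : a \in M by apply: LM; rewrite mem_head.
rewrite big_cons (perm_big _ (perm_to_rem aM))/= big_cons lerD2l.
apply: IH => //.
  move=> x xL; have xM : x \in M by apply: LM; rewrite inE xL orbT.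
  have : x \in a :: rem a M by rewrite -(perm_mem (perm_to_rem aM)).
  by rewrite inE => /orP[/eqP xa|//]; move: aL; rewrite -xa xL.
by move=> x /mem_rem; exact: F0.
Qed.

(** Expanding the factor of one prime [p] leaves the sum over multiples of [d] and [lam] times the
    sum over multiples of [d p]; the divisor [d] is carried along so that the induction covers
    both. *)
Lemma sum_multiples_prod (lam : R) (Q : seq nat) (d n : nat) : 0 <= lam ->
  uniq Q -> all prime Q -> (0 < d)%N -> all (fun p => ~~ (p %| d)%N) Q ->
  \sum_(1 <= r < n.+1 | (d %| r)%N) \prod_(p <- Q) (1 + lam * (p %| r)%N%:R) <=
  n%:R / d%:R * \prod_(p <- Q) (1 + lam / p%:R).
Proof.
move=> lam0; elim: Q d => [|p Q IH] d /=.
  move=> _ _ d0 _; rewrite big_nil mulr1.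
  under eq_bigr do rewrite big_nil.
  have -> : \sum_(1 <= r < n.+1 | (d %| r)%N) (1 : R) = (n %/ d)%N%:R.
    by rewrite divn_count_dvd natr_sum big_mkcond/=; apply: eq_bigr => i _; case: (_ %| _)%N.
  by rewrite ler_pdivlMr ?ltr0n// -natrM ler_nat leq_divM.
move=> /andP[pQ uQ] /andP[pp aQ] d0 /andP[pd aQd].
have p0 : (0 < p)%N by exact: prime_gt0.
under eq_bigr do rewrite big_cons.
rewrite big_cons.
have -> : \sum_(1 <= r < n.+1 | (d %| r)%N)
      (1 + lam * (p %| r)%N%:R) * \prod_(p <- Q) (1 + lam * (p %| r)%N%:R) =
    \sum_(1 <= r < n.+1 | (d %| r)%N) \prod_(p <- Q) (1 + lam * (p %| r)%N%:R) +
    lam * \sum_(1 <= r < n.+1 | (d * p %| r)%N) \prod_(p <- Q) (1 + lam * (p %| r)%N%:R).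
  rewrite mulr_sumr [X in _ + X]big_mkcond [X in X + _]big_mkcond [LHS]big_mkcond/=.
  rewrite -big_split/=; apply: eq_bigr => r _.
  rewrite Gauss_dvd; last by rewrite coprime_sym prime_coprime.
  by case: (d %| r)%N => /=; case: (p %| r)%N => /=; rewrite ?mulr1 ?mulr0 ?addr0 ?mul1r// mulrDl mul1r.
have h1 := IH d uQ aQ d0 aQd.
have dp0 : (0 < d * p)%N by rewrite muln_gt0 d0.
have aQdp : all (fun q => ~~ (q %| d * p)%N) Q.
  apply/allP => q qQ; have qp : prime q := allP aQ q qQ.
  rewrite Euclid_dvdM// negb_or (allP aQd)//= dvdn_prime2//.
  by apply: contra pQ => /eqP <-.
have h2 := ler_wpM2l lam0 (IH _ uQ aQ dp0 aQdp).
apply: le_trans (lerD h1 h2) _; rewrite natrM le_eqVlt; apply/orP; left; apply/eqP.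
by field; rewrite !pnatr_eq0 -!lt0n d0 p0.
Qed.

Lemma sum_riemann_le (d : R) N : 0 < d < 1 ->
  \sum_(1 <= n < N.+1) n%:R `^ (- (1 + d)) <= 1 + d^-1 - d^-1 * N.+1%:R `^ (- d) + d^-1.
Proof.
move=> d01; have /andP[d0 d1] := d01.
have di : 0 <= d^-1 by rewrite invr_ge0 ltW.
case: N => [|N].
  rewrite big_geq// powR1 mulr1; lra.
(* Integral comparison by telescoping: [d m^(-(1+d)) <= (m - 1)^(-d) - m^(-d)], from Bernoulli's
   inequality for [(1 - 1/m)^d]. *)
suff : \sum_(1 <= n < N.+2) n%:R `^ (- (1 + d)) <= 1 + d^-1 - d^-1 * N.+1%:R `^ (- d).
  have : N.+2%:R `^ (- d) <= 1 :> R.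
    by rewrite powRN invf_le1 ?powR_gt0// powR_ge1// ?ler1n// ltW.
  move=> h1; have := ler_wpM2l di h1; rewrite mulr1.
  have := mulr_ge0 di (powR_ge0 N.+1%:R (- d)); lra.
elim: N => [|N IH].
  by rewrite big_nat1 !powR1; lra.
rewrite big_nat_recr//=; apply: le_trans (lerD IH (lexx _)) _.
have [m mE] : exists m : R, m = N.+2%:R by exists N.+2%:R.
rewrite -mE; have m0 : 0 < m by rewrite mE ltr0n.
have mi : 0 < m^-1 by rewrite invr_gt0.
have m1 : m^-1 < 1 by rewrite invf_lt1// mE ltr1n.
have e : N.+1%:R = m * (1 - m^-1) :> R.
  by rewrite mulrBr mulr1 divff ?gt_eqF// mE -[N.+2]addn1 natrD addrK.
have hb : (1 - m^-1) `^ d <= 1 - d * m^-1 by apply: powR_bernoulli; rewrite // !ltW.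
have hp : 0 < (1 - m^-1) `^ d by rewrite powR_gt0// subr_gt0.
have step : 1 + d / m <= (1 - m^-1) `^ (- d).
  rewrite powRN -[leRHS]mul1r ler_pdivlMr//.
  apply: (@le_trans _ _ ((1 + d / m) * (1 - d / m))).
    by rewrite ler_wpM2l// addr_ge0// divr_ge0// ltW.
  have : 0 <= (d / m) ^+ 2 by rewrite sqr_ge0.
  by rewrite expr2; lra.
rewrite e powRM ?(ltW m0)//; last by rewrite subr_ge0 ltW.
have -> : m `^ (- (1 + d)) = m `^ (- d) / m.
  by rewrite opprD addrC powRDpos// powR_inv1 ?(ltW m0).
have md : 0 <= d^-1 * m `^ (- d) by rewrite mulr_ge0// powR_ge0.
have := ler_wpM2l md step.
have -> : d^-1 * m `^ (- d) * (1 + d / m) = d^-1 * m `^ (- d) + m `^ (- d) / m.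
  by field; rewrite !gt_eqF.
lra.
Qed.

Lemma sum_riemann_uniq (d : R) (L : seq nat) : 0 < d < 1 -> uniq L ->
  all (fun p => 0 < p)%N L ->
  \sum_(p <- L) p%:R `^ (- (1 + d)) <= 1 + d^-1 + d^-1.
Proof.
move=> d01 uL aL; have /andP[d0 _] := d01.
apply: (@le_trans _ _ (\sum_(1 <= n < (\max_(p <- L) p).+1) n%:R `^ (- (1 + d)))).
  apply: sum_uniq_subset => [//|p pL|x _]; last by rewrite /= powR_ge0.
  rewrite mem_index_iota (allP aL _ pL)/= ltnS.
  by rewrite (big_rem p)//= leq_maxl.
apply: le_trans (sum_riemann_le _ d01) _.
have : 0 <= d^-1 * (\max_(p <- L) p).+1%:R `^ (- d).
  by rewrite mulr_ge0 ?powR_ge0// invr_ge0 ltW.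
lra.
Qed.

(** * Chebyshev's bound on dyadic blocks and the reciprocals of the primes *)

Lemma prod_primes_dvd (s : seq nat) X : uniq s -> all prime s ->
  all (fun p => p %| X)%N s -> (\prod_(p <- s) p %| X)%N.
Proof.
elim: s => [|p s IH] /=; first by rewrite big_nil dvd1n.
move=> /andP[ps us] /andP[pp aps] /andP[pX asX].
rewrite big_cons Gauss_dvd ?pX ?IH//.
rewrite prime_coprime//; apply/negP => h.
have : has (fun q => p %| q)%N s.
  elim: s {IH us ps asX} aps h => [|q s IH] /=.
    by rewrite big_nil dvdn1 => _ /eqP p1; move: pp; rewrite p1.
  by move=> /andP[_ aps]; rewrite big_cons Euclid_dvdM// => /orP[->|/(IH aps) ->]//; rewrite orbT.
case/hasP => q qs; rewrite dvdn_prime2 ?(allP aps _ qs)// => /eqP pq.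
by move: ps; rewrite pq qs.
Qed.

Lemma prime_dvd_factorial p m : prime p -> (p %| m`!)%N -> (p <= m)%N.
Proof.
move=> pp; elim: m => [|m IH]; first by rewrite fact0 dvdn1 => /eqP p1; move: pp; rewrite p1.
rewrite factS Euclid_dvdM// => /orP[/dvdn_leq -> //|/IH /leq_trans -> //].
Qed.

Lemma central_binomial_le m : ('C(m.*2, m) <= 2 ^ m.*2)%N.
Proof.
rewrite -[2%N]/(1 + 1)%N expnDn.
have mm : (m < m.*2.+1)%N by rewrite ltnS -addnn leq_addr.
rewrite (bigD1 (Ordinal mm))//= !exp1n !muln1 leq_addr//.
Qed.

(** With [m = 2^k], the primes in [(m, 2m]] all divide the central binomial coefficient, which is at
    most [2^(2m)], and each exceeds [m]; comparing exponents of [2] finishes. *)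
Lemma dyadic_prime_count k :
  (k * count prime (index_iota (2 ^ k).+1 (2 ^ k.+1).+1) <= 2 ^ k.+1)%N.
Proof.
set m := (2 ^ k)%N; have e2 : (2 ^ k.+1 = m.*2)%N by rewrite expnS mul2n.
rewrite e2; set s := [seq p <- index_iota m.+1 m.*2.+1 | prime p].
have -> : count prime (index_iota m.+1 m.*2.+1) = size s by rewrite size_filter.
have us : uniq s by rewrite filter_uniq// iota_uniq.
have aps : all prime s by apply/allP => p; rewrite mem_filter => /andP[].
have dv : (\prod_(p <- s) p %| 'C(m.*2, m))%N.
  apply: prod_primes_dvd => //; apply/allP => p; rewrite mem_filter mem_index_iota.
  move=> /andP[pp /andP[mp pm]].
  have mm : (m <= m.*2)%N by rewrite -addnn leq_addr.
  have := bin_fact mm; have -> : (m.*2 - m = m)%N by rewrite -addnn addnK.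
  move=> ef; have : (p %| (m.*2)`!)%N by rewrite dvdn_fact// prime_gt0.
  rewrite -ef !Euclid_dvdM// => /orP[//|].
  by rewrite orbb => /(prime_dvd_factorial pp); rewrite leqNgt mp.
have c0 : (0 < 'C(m.*2, m))%N by rewrite bin_gt0 -addnn leq_addr.
have h1 := leq_trans (dvdn_leq c0 dv) (central_binomial_le m).
have h2 : (m ^ size s <= \prod_(p <- s) p)%N.
  have : all (fun p => m <= p)%N s.
    by apply/allP => p; rewrite mem_filter mem_index_iota => /andP[_ /andP[/ltnW]].
  elim: (s) => [|p t IH] /=; first by rewrite big_nil.
  by move=> /andP[mp /IH ht]; rewrite big_cons expnS leq_mul.
have := leq_trans h2 h1; rewrite /m -expnM leq_exp2l//.
Qed.

Lemma sum_inv_le_ln n : (0 < n)%N -> \sum_(1 <= k < n.+1) (k%:R : R)^-1 <= 1 + ln n%:R.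
Proof.
elim: n => [//|[|n] IH] _; first by rewrite big_nat1 invr1 ln1 addr0.
rewrite big_nat_recr//=; apply: le_trans (lerD (IH isT) (lexx _)) _.
have [m mE] : exists m : R, m = n.+2%:R by exists n.+2%:R.
rewrite -mE; have m0 : 0 < m by rewrite mE ltr0n.
have m1 : m^-1 < 1 by rewrite invf_lt1// mE ltr1n.
have e : n.+1%:R = m * (1 - m^-1) :> R.
  by rewrite mulrBr mulr1 divff ?gt_eqF// mE -[n.+2]addn1 natrD addrK.
rewrite e lnM ?posrE ?subr_gt0//.
have : ln (1 - m^-1) <= - m^-1 by apply: le_ln1Dx; rewrite ltrN2.
lra.
Qed.

(** The block [(2^k, 2^(k+1)]] has at most [2^(k+1) / k] primes, each contributing less than
    [2^(-k)], so it gives at most [2 / k]. The leading [1] covers the prime [2]. *)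
Lemma sum_prime_inv_dyadic n : (0 < n)%N ->
  \sum_(1 <= p < (2 ^ n).+1 | prime p) (p%:R : R)^-1 <= 1 + 2 * \sum_(1 <= k < n) (k%:R : R)^-1.
Proof.
elim: n => [//|[|n] IH] _.
  rewrite [X in _ * X]big_geq// mulr0 addr0 expn1.
  rewrite big_mkcond big_nat_recr//= big_nat1/= add0r.
  by rewrite invf_le1 ?ler1n.
rewrite (big_cat_nat _ (n := (2 ^ n.+1).+1))//=; last by rewrite ltnS leq_exp2l.
rewrite [X in _ <= _ + 2 * X]big_nat_recr//= mulrDr addrA.
apply: lerD; first exact: IH.
set m := (2 ^ n.+1)%N; have m0 : (0 < m)%N by rewrite expn_gt0.
apply: (@le_trans _ _ (\sum_(m.+1 <= p < (2 ^ n.+2).+1 | prime p) (m%:R)^-1)).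
  rewrite big_nat_cond [leRHS]big_nat_cond; apply: ler_sum => p /andP[/andP[mp _] _].
  by rewrite lef_pV2 ?posrE ?ltr0n ?ler_nat//; lia.
rewrite -big_filter big_const_seq count_predT iter_addr_0 size_filter.
have := dyadic_prime_count n.+1; rewrite -/m.
have -> : (2 ^ n.+2 = 2 * m)%N by rewrite expnS.
set c := count _ _ => hc.
rewrite -[leLHS]mulr_natr ler_pdivlMr ?ltr0n// -mulrA ler_pdivrMl ?ltr0n//.
rewrite -!natrM ler_nat; lia.
Qed.

(** Mertens' estimate with leading coefficient [2] in place of [1], which the exponent of [Logt t]
    leaves room for. *)
Lemma sum_prime_inv_le (t : R) (L : seq nat) : 1 <= t -> uniq L -> all prime L ->
  all (fun p => p%:R <= t) L ->
  \sum_(p <- L) (p%:R : R)^-1 <= 7 + 2 * ln (Logt t).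
Proof.
move=> t1 uL apL atL; have t0 : 0 < t by lra.
have lt0 : 0 <= ln t by exact: ln_ge0.
(* As [ln 2 >= 1/2], any [n >= 2 ln t] satisfies [t <= 2^n]. *)
pose n := (Num.truncn (2 * ln t)).+1.
have lt2 : 0 <= 2 * ln t by lra.
have /andP[n1 n2] := truncn_itv lt2.
have nu : n%:R <= 1 + 2 * ln t by rewrite /n -addn1 natrD addrC lerD2l.
have L1 : 1 <= Logt t by rewrite le_max lexx.
have L2 : ln t <= Logt t by rewrite le_max lexx orbT.
have n3 : n%:R <= 3 * Logt t by lra.
have ln2 : 1 / 2 <= ln 2 :> R.
  have : ln (1 + - (1 / 2)) <= - (1 / 2) :> R by apply: le_ln1Dx; lra.
  by rewrite (_ : 1 + - (1 / 2) = 2^-1 :> R) ?lnV ?posrE//; lra.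
have t2n : t <= 2 ^+ n.
  rewrite -ler_ln ?posrE ?exprn_gt0// lnXn// -[leRHS]mulr_natl.
  have := ler_wpM2l (ler0n R n) ln2.
  by move: n2; rewrite -/n; move: (n%:R : R); clear; move=> x; lra.
apply: (@le_trans _ _ (\sum_(1 <= p < (2 ^ n).+1 | prime p) (p%:R : R)^-1)).
  rewrite -[leRHS]big_filter; apply: sum_uniq_subset => [//|p pL|p _]; last by rewrite invr_ge0 ler0n.
  rewrite mem_filter mem_index_iota (allP apL)//= prime_gt0 ?(allP apL)//= ltnS.
  by rewrite -(ler_nat R) natrX (le_trans (allP atL _ pL)).
apply: le_trans (sum_prime_inv_dyadic _) _ => //.
have hn := sum_inv_le_ln (ltn0Sn (Num.truncn (2 * ln t))).
rewrite -/n big_nat_recr//= in hn.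
have ni : 0 <= (n%:R : R)^-1 by rewrite invr_ge0.
have L0 : 0 < Logt t := lt_le_trans ltr01 L1.
have n0 : 0 < n%:R :> R by rewrite ltr0n.
have lnn : ln n%:R <= 2 + ln (Logt t).
  apply: (@le_trans _ _ (ln (3 * Logt t))).
    by rewrite ler_ln// posrE// mulr_gt0.
  rewrite lnM ?posrE// lerD2r.
  have -> : 3 = 1 + 2 :> R by rewrite -natr1 addrC.
  by apply: le_ln1Dx; rewrite (lt_trans (_ : _ < 0)) ?ltrN10.
move: hn ni lnn; move: (ln n%:R) (n%:R^-1 : R) (ln (Logt t)) (\sum_(1 <= k < n) _).
by clear; move=> a b c e; lra.
Qed.

End PrimeSums.

(** * Removing primes one at a time *)

Section Terminal.
Variable R : realType.

Lemma powR_sqr_half (a : R) : 0 <= a -> (a ^+ 2) `^ (1 / 2) = a.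
Proof.
move=> a0; rewrite -(powR_mulrn 2 a0) -powRrM mul1r divff ?powRr1//.
Qed.

Lemma cauchy_schwarz_powR (I : finType) (D : pred I) (al be : I -> R) :
  (forall i, D i -> 0 <= al i) -> (forall i, D i -> 0 <= be i) ->
  \sum_(i | D i) (al i * be i) `^ (1 / 2) <=
  ((\sum_(i | D i) al i) * (\sum_(i | D i) be i)) `^ (1 / 2).
Proof.
move=> al0 be0; set X := \sum_(i | D i) al i; set Y := \sum_(i | D i) be i.
have h12 : (1 / 2 : R) != 0 by rewrite mul1r invr_eq0 pnatr_eq0.
have alX i : D i -> al i <= X.
  by move=> Di; rewrite /X (bigD1 i)//= lerDl sumr_ge0// => j /andP[/al0].
have beY i : D i -> be i <= Y.
  by move=> Di; rewrite /Y (bigD1 i)//= lerDl sumr_ge0// => j /andP[/be0].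
have X0 : 0 <= X by exact: sumr_ge0.
have Y0 : 0 <= Y by exact: sumr_ge0.
have [XY|XYn] := eqVneq (X * Y) 0.
  rewrite XY powR0// big1// => i Di.
  have -> : al i * be i = 0.
    apply/eqP; rewrite eq_le mulr_ge0 ?al0 ?be0// andbT -XY.
    by apply: ler_pM; rewrite ?al0 ?be0 ?alX ?beY.
  by rewrite powR0.
move: XYn; rewrite mulf_eq0 negb_or => /andP[Xn Yn].
have Xp : 0 < X by rewrite lt_neqAle eq_sym Xn.
have Yp : 0 < Y by rewrite lt_neqAle eq_sym Yn.
have term i : D i -> (al i * be i) `^ (1 / 2) <=
   (X * Y) `^ (1 / 2) * ((al i / X + be i / Y) / 2).
  move=> Di; have -> : al i * be i = (X * Y) * ((al i / X) * (be i / Y)).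
    by field; rewrite Xn Yn.
  rewrite powRM ?mulr_ge0 ?invr_ge0 ?al0 ?be0// ler_wpM2l ?powR_ge0//.
  by apply: powR_mean; rewrite // divr_ge0 ?al0 ?be0//= ler_pdivrMr ?mul1r ?alX ?beY.
apply: le_trans (ler_sum _ term) _.
rewrite -mulr_sumr -mulr_suml big_split/= -!mulr_suml !divff//.
by rewrite mulr1.
Qed.

End Terminal.

(** * Graphs with some primes removed, and the terminal case *)

Section States.
Variables (R : realType) (s C : R) (I J : finType).
Variables (f g : nat -> R) (phi x : I -> R) (phi' y : J -> R).
Variables (T : pred nat) (Q : seq nat).
Hypotheses (s_gt : 1 / 2 < s) (s_le : s <= 9 / 10) (C_gt0 : 0 < C).
Hypotheses (phi_ge0 : forall i, 0 <= phi i) (x_ge0 : forall i, 0 <= x i).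
Hypotheses (phi'_ge0 : forall j, 0 <= phi' j) (y_ge0 : forall j, 0 <= y j).
Hypotheses (Q_uniq : uniq Q) (Q_prime : all prime Q).

Definition omega_in (r : nat) : nat := count (fun p => p %| r)%N Q.

(** Together with [omega_in] of the removed parts this stands in for [omega_t]: a prime divides
    [v w / gcd(v, w)^2] exactly when its exponents in [v] and [w] differ. *)
Definition exp_diff (L : seq nat) (m n : nat) : nat :=
  count (fun p => T p && (logn p m != logn p n)) L.

(* [r i] collects the primes of the vertex [i] that have already been dealt with,
   up to a common factor absorbed in [c]; [o i] is its part on the remaining primes. *)
Record side (w : nat -> R) (V : finType) (ph : V -> R) (L : seq nat)
    (A : pred V) (r o : V -> nat) (c : R) : Prop := Side {
  side_ge0 : 0 <= c;
  side_r_gt0 : forall i, A i -> (0 < r i)%N;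
  side_o_gt0 : forall i, A i -> (0 < o i)%N;
  side_coprime : forall i p, A i -> p \in L -> ~~ (p %| r i)%N;
  side_support : forall i p, A i -> prime p -> (p %| o i)%N -> p \in L;
  side_weight : forall i, A i -> ph i <= c * (r i)%:R * w (o i);
  side_inj : forall i i', A i -> A i' -> r i = r i' -> o i = o i' -> i = i' }.

(** The condition [D <= 1] in terms of states: [l] collects what was removed from both sides
    jointly, and [l r r' lcm(o, o')] takes the place of the least common multiple of the two
    vertices. *)
Definition edges (L : seq nat) (A : pred I) (B : pred J) (E : I -> J -> bool)
    (r o : I -> nat) (r' o' : J -> nat) (l K : R) : Prop :=
  forall i j, A i -> B j -> E i j ->
  [/\ x i * (l * (r i * r' j * lcmn (o i) (o' j))%:R) <= 1,
      y j * (l * (r i * r' j * lcmn (o i) (o' j))%:R) <= 1 &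
      K <= (omega_in (r i) + omega_in (r' j) + exp_diff L (o i) (o' j))%:R].

Definition mass (V : finType) (ph z : V -> R) (A : pred V) : R :=
  \sum_(i | A i) ph i * z i.

Definition edge_mass (A : pred I) (B : pred J) (E : I -> J -> bool) : R :=
  \sum_(u : I * J | [&& A u.1, B u.2 & E u.1 u.2])
    (phi u.1 * x u.1) * (phi' u.2 * y u.2).

(** The induction statement. It ranges over all states because removing a prime leads to subgraphs
    with other values of [c], [l] and [K]; the power [1 - s] of [cA cB / l^2] lets the costs of
    these changes multiply. *)
Definition bounded (L : seq nat) (M : R) : Prop :=
  forall A B E r o r' o' cA cB l K, 0 < l ->
  side f phi L A r o cA -> side g phi' L B r' o' cB ->
  edges L A B E r o r' o' l K ->
  edge_mass A B E <=
    M * (cA * cB / l ^+ 2) `^ (1 - s) * (mass phi x A * mass phi' y B) `^ s *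
    expR (- (C * K * s)).

(** Chosen with [H^(1 - s) = e^(C s)]: the Cauchy-Schwarz bound carries [H^(-K/2)] and enters with
    the power [2 (1 - s)]. *)
Let H : R := expR (C * (s / (1 - s))).

Definition omega_mean : R := \prod_(p <- Q) (1 + (H - 1) / p%:R).

Lemma H_ge1 : 1 <= H.
Proof.
rewrite /H -[leLHS]expR0 ler_expR mulr_ge0 ?(ltW C_gt0)// divr_ge0//.
  by move: (s_gt); lra.
by move: (s_le); lra.
Qed.

Lemma expR_omega r : H ^+ omega_in r = \prod_(p <- Q) (1 + (H - 1) * (p %| r)%N%:R).
Proof.
rewrite /omega_in; elim: Q => [|p q IH] /=; first by rewrite big_nil expr0.
rewrite big_cons -IH exprD; case: (p %| r)%N => /=.
  by rewrite expr1 mulr1 addrC subrK.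
by rewrite expr0 mulr0 addr0.
Qed.

Lemma omega_mean_ge0 : 0 <= omega_mean.
Proof.
rewrite /omega_mean; apply: prodr_ge0 => p _.
by rewrite addr_ge0// divr_ge0// subr_ge0 H_ge1.
Qed.

(** By injectivity the [r j] are distinct positive integers up to [Z], so [sum_multiples_prod] with
    divisor [1] applies to the sum over all such integers. *)
Lemma row_sum_le (V : finType) (D : pred V) (r : V -> nat) (Z : R) :
  {in D &, injective r} -> (forall j, D j -> (0 < r j)%N) ->
  (forall j, D j -> (r j)%:R <= Z) -> 0 <= Z ->
  \sum_(j | D j) H ^+ omega_in (r j) <= Z * omega_mean.
Proof.
move=> r_inj r0 rZ Z0; have /andP[n1 n2] := truncn_itv Z0.
set n := Num.truncn Z in n1 n2.
have -> : \sum_(j | D j) H ^+ omega_in (r j) =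
    \sum_(m <- [seq r j | j <- enum D]) H ^+ omega_in m.
  by rewrite big_map big_enum.
apply: (@le_trans _ _ (\sum_(1 <= m < n.+1) H ^+ omega_in m)).
  apply: sum_uniq_subset => [|m|m _].
  - rewrite map_inj_in_uniq ?enum_uniq// => j j'; rewrite !mem_enum; exact: r_inj.
  - move=> /mapP[j]; rewrite mem_enum => Dj ->; rewrite mem_index_iota r0//=.
    by rewrite -(ltr_nat R); apply: le_lt_trans n2; exact: rZ.
  - by rewrite exprn_ge0// (le_trans ler01 H_ge1).
have H1 : 0 <= H - 1 by rewrite subr_ge0 H_ge1.
have a1 : all (fun p => ~~ (p %| 1)%N) Q.
  by apply/allP => p pQ; rewrite dvdn1 neq_ltn prime_gt1 ?orbT// (allP Q_prime).
have := @sum_multiples_prod R (H - 1) Q 1 n H1 Q_uniq Q_prime isT a1.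
rewrite [X in X <= _](_ : _ = \sum_(1 <= m < n.+1) H ^+ omega_in m); last first.
  by apply: eq_big => m; rewrite ?dvd1n// expR_omega.
rewrite divr1 -/omega_mean => /le_trans; apply.
by rewrite ler_wpM2r// omega_mean_ge0.
Qed.

Lemma mass_ge0 (V : finType) (ph z : V -> R) (A : pred V) :
  (forall i, 0 <= ph i) -> (forall i, 0 <= z i) -> 0 <= mass ph z A.
Proof. by move=> p0 z0; rewrite sumr_ge0// => i _; rewrite mulr_ge0. Qed.

Lemma edge_mass_ge0 A B E : 0 <= edge_mass A B E.
Proof. by rewrite sumr_ge0// => u _; rewrite !mulr_ge0. Qed.

Lemma edge_mass_le A B E : edge_mass A B E <= mass phi x A * mass phi' y B.
Proof.
rewrite /mass mulr_suml; under [leRHS]eq_bigr do rewrite mulr_sumr.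
rewrite pair_big/= /edge_mass big_mkcond [leRHS]big_mkcond/=.
apply: ler_sum => u _; case: (A u.1) => //=; case: (B u.2) => //=.
by case: ifP => // _; rewrite !mulr_ge0.
Qed.

Lemma edge_mass_rows (A : pred I) (B : pred J) E (a : I -> R) (w : I -> J -> R) (U : R) :
  (forall i, A i -> a i * (\sum_(j | B j && E i j) w i j) <= a i * U) ->
  \sum_(u : I * J | [&& A u.1, B u.2 & E u.1 u.2]) a u.1 * w u.1 u.2 <=
  (\sum_(i | A i) a i) * U.
Proof.
move=> h; rewrite mulr_suml.
rewrite -(pair_big_dep A (fun i j => B j && E i j) (fun i j => a i * w i j))/=.
by apply: ler_sum => i Ai; rewrite -mulr_sumr h.
Qed.

Lemma edge_mass_cols (A : pred I) (B : pred J) E (b : J -> R) (w : I -> J -> R) (U : R) :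
  (forall j, B j -> b j * (\sum_(i | A i && E i j) w i j) <= b j * U) ->
  \sum_(u : I * J | [&& A u.1, B u.2 & E u.1 u.2]) b u.2 * w u.1 u.2 <=
  (\sum_(j | B j) b j) * U.
Proof.
move=> h; rewrite mulr_suml.
rewrite (eq_bigl (fun u : I * J => A u.1 && (B u.2 && E u.1 u.2)))//.
rewrite -(pair_big_dep A (fun i j => B j && E i j) (fun i j => b j * w i j))/=.
rewrite (exchange_big_dep B)/=; last by move=> i j _ /andP[].
apply: ler_sum => j Bj; rewrite -mulr_sumr; apply: le_trans (h j Bj).
rewrite le_eqVlt; apply/orP; left; apply/eqP; congr (_ * _).
by apply: eq_bigl => i; rewrite Bj.
Qed.

Lemma bounded_nil : f 1%N = 1 -> g 1%N = 1 ->
  bounded [::] (omega_mean `^ (2 * (1 - s))).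
Proof.
move=> f1 g1 A B E r o r' o' cA cB l K l0 sA sB hE.
have no_prime n : (0 < n)%N -> (forall p, prime p -> (p %| n)%N -> p \in [::]) -> n = 1%N.
  move=> n0 hn; apply/eqP; rewrite eqn_leq n0 andbT leqNgt; apply/negP => n1.
  by have := hn _ (pdiv_prime n1) (pdiv_dvd n).
have o1 i : A i -> o i = 1%N.
  move=> Ai; apply: no_prime (side_o_gt0 sA Ai) _ => p; exact: (side_support sA Ai).
have o1' j : B j -> o' j = 1%N.
  move=> Bj; apply: no_prime (side_o_gt0 sB Bj) _ => p; exact: (side_support sB Bj).
set X := mass phi x A; set Y := mass phi' y B; set tot := edge_mass A B E.
have X0 : 0 <= X by exact: mass_ge0.
have Y0 : 0 <= Y by exact: mass_ge0.
have tot0 : 0 <= tot by exact: edge_mass_ge0.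
have M0 := omega_mean_ge0; have H1 := H_ge1.
have H0 : 0 < H by exact: expR_gt0.
have cA0 := side_ge0 sA; have cB0 := side_ge0 sB.
(* In [al * be] the ratios of [r] and [r'] cancel. In [al], the bound [phi' j <= cB * r' j] removes
   the denominator, and the edge condition confines [r' j] to at most [1 / (l * r i * x i)], so that
   the sum over [j] no longer depends on [i]. *)
pose al (i : I) (j : J) : R := phi' j * ((r i)%:R / (r' j)%:R) * H ^+ omega_in (r' j) * x i.
pose be (i : I) (j : J) : R := phi i * ((r' j)%:R / (r i)%:R) * H ^+ omega_in (r i) * y j.
have al0 i j : 0 <= al i j by rewrite !mulr_ge0 ?invr_ge0 ?exprn_ge0// ltW.
have be0 i j : 0 <= be i j by rewrite !mulr_ge0 ?invr_ge0 ?exprn_ge0// ltW.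
have E1 i j : A i -> B j -> E i j ->
   [/\ x i * (l * ((r i)%:R * (r' j)%:R)) <= 1, y j * (l * ((r i)%:R * (r' j)%:R)) <= 1 &
   K <= (omega_in (r i) + omega_in (r' j))%:R].
  move=> Ai Bj Eij; have [] := hE i j Ai Bj Eij.
  by rewrite o1// o1'// lcm1n muln1 natrM addn0.
have row1 i : A i -> phi i * x i * (\sum_(j | B j && E i j) al i j) <= phi i * x i * (cB * omega_mean / l).
  move=> Ai; have [->|xn0] := eqVneq (x i) 0; first by rewrite mulr0 !mul0r.
  have xp : 0 < x i by rewrite lt_neqAle eq_sym xn0 x_ge0.
  have rp : 0 < (r i)%:R :> R by rewrite ltr0n (side_r_gt0 sA).
  rewrite ler_wpM2l ?mulr_ge0//.
  pose Z := (l * (r i)%:R * x i)^-1.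
  have lrx : 0 < l * (r i)%:R * x i by rewrite !mulr_gt0.
  have Z0 : 0 <= Z by rewrite invr_ge0 ltW.
  have st j : B j && E i j -> al i j <= cB * (r i)%:R * x i * H ^+ omega_in (r' j).
    move=> /andP[Bj _]; have rp' : 0 < (r' j)%:R :> R by rewrite ltr0n (side_r_gt0 sB).
    have := side_weight sB Bj; rewrite o1'// g1 mulr1 => hw.
    rewrite /al; have -> : cB * (r i)%:R * x i * H ^+ omega_in (r' j) =
      cB * (r' j)%:R * ((r i)%:R / (r' j)%:R) * H ^+ omega_in (r' j) * x i.
      by field; rewrite gt_eqF.
    do 3![rewrite ler_wpM2r ?exprn_ge0 ?mulr_ge0 ?invr_ge0 ?(ltW H0)//].
  apply: le_trans (ler_sum _ st) _; rewrite -mulr_sumr.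
  have rs : \sum_(j | B j && E i j) H ^+ omega_in (r' j) <= Z * omega_mean.
    apply: row_sum_le => //.
    - move=> j j' /andP[Bj _] /andP[Bj' _] e.
      by apply: (side_inj sB) => //; rewrite !o1'.
    - by move=> j /andP[/(side_r_gt0 sB)].
    - move=> j /andP[Bj Eij]; have [h _ _] := E1 i j Ai Bj Eij.
      rewrite -[Z]mul1r ler_pdivlMr//; apply: le_trans h.
      by rewrite le_eqVlt; apply/orP; left; apply/eqP; ring.
  have c0 : 0 <= cB * (r i)%:R * x i by rewrite !mulr_ge0.
  apply: le_trans (ler_wpM2l c0 rs) _; rewrite le_eqVlt; apply/orP; left; apply/eqP.
  by rewrite /Z; field; rewrite !gt_eqF.
have row2 j : B j -> phi' j * y j * (\sum_(i | A i && E i j) be i j) <= phi' j * y j * (cA * omega_mean / l).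
  move=> Bj; have [->|yn0] := eqVneq (y j) 0; first by rewrite mulr0 !mul0r.
  have yp : 0 < y j by rewrite lt_neqAle eq_sym yn0 y_ge0.
  have rp : 0 < (r' j)%:R :> R by rewrite ltr0n (side_r_gt0 sB).
  rewrite ler_wpM2l ?mulr_ge0//.
  pose Z := (l * (r' j)%:R * y j)^-1.
  have lry : 0 < l * (r' j)%:R * y j by rewrite !mulr_gt0.
  have Z0 : 0 <= Z by rewrite invr_ge0 ltW.
  have st i : A i && E i j -> be i j <= cA * (r' j)%:R * y j * H ^+ omega_in (r i).
    move=> /andP[Ai _]; have rp' : 0 < (r i)%:R :> R by rewrite ltr0n (side_r_gt0 sA).
    have := side_weight sA Ai; rewrite o1// f1 mulr1 => hw.
    rewrite /be; have -> : cA * (r' j)%:R * y j * H ^+ omega_in (r i) =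
      cA * (r i)%:R * ((r' j)%:R / (r i)%:R) * H ^+ omega_in (r i) * y j.
      by field; rewrite gt_eqF.
    do 3![rewrite ler_wpM2r ?exprn_ge0 ?mulr_ge0 ?invr_ge0 ?(ltW H0)//].
  apply: le_trans (ler_sum _ st) _; rewrite -mulr_sumr.
  have rs : \sum_(i | A i && E i j) H ^+ omega_in (r i) <= Z * omega_mean.
    apply: row_sum_le => //.
    - move=> i i' /andP[Ai _] /andP[Ai' _] e.
      by apply: (side_inj sA) => //; rewrite !o1.
    - by move=> i /andP[/(side_r_gt0 sA)].
    - move=> i /andP[Ai Eij]; have [_ h _] := E1 i j Ai Bj Eij.
      rewrite -[Z]mul1r ler_pdivlMr//; apply: le_trans h.
      by rewrite le_eqVlt; apply/orP; left; apply/eqP; ring.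
  have c0 : 0 <= cA * (r' j)%:R * y j by rewrite !mulr_ge0.
  apply: le_trans (ler_wpM2l c0 rs) _; rewrite le_eqVlt; apply/orP; left; apply/eqP.
  by rewrite /Z; field; rewrite !gt_eqF.
have sum1 := @edge_mass_rows A B E (fun i => phi i * x i) al _ row1.
have sum2 := @edge_mass_cols A B E (fun j => phi' j * y j) be _ row2.
have half : H `^ (K / 2) * tot <= omega_mean * ((cA * cB / l ^+ 2) * (X * Y)) `^ (1 / 2).
  have a0 (u : I * J) : [&& A u.1, B u.2 & E u.1 u.2] -> 0 <= phi u.1 * x u.1 * al u.1 u.2.
    by move=> _; exact: mulr_ge0 (mulr_ge0 (phi_ge0 _) (x_ge0 _)) (al0 _ _).
  have b0 (u : I * J) : [&& A u.1, B u.2 & E u.1 u.2] -> 0 <= phi' u.2 * y u.2 * be u.1 u.2.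
    by move=> _; exact: mulr_ge0 (mulr_ge0 (phi'_ge0 _) (y_ge0 _)) (be0 _ _).
  have cs := cauchy_schwarz_powR a0 b0.
  have -> : omega_mean * ((cA * cB / l ^+ 2) * (X * Y)) `^ (1 / 2) =
     ((X * (cB * omega_mean / l)) * (Y * (cA * omega_mean / l))) `^ (1 / 2).
    have -> : (X * (cB * omega_mean / l)) * (Y * (cA * omega_mean / l)) =
      omega_mean ^+ 2 * ((cA * cB / l ^+ 2) * (X * Y)).
      by field; rewrite gt_eqF.
    rewrite [RHS]powRM ?sqr_ge0//; last by rewrite !mulr_ge0// invr_ge0 sqr_ge0.
    by rewrite powR_sqr_half.
  refine (le_trans _ (le_trans cs _)); last first.
    apply: le_powR => //; first by rewrite mulr_ge0 ?sumr_ge0.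
    by apply: ler_pM; rewrite ?sumr_ge0.
  rewrite /tot /edge_mass mulr_sumr; apply: ler_sum => u /and3P[Au Bu Eu].
  have rp : 0 < (r u.1)%:R :> R by rewrite ltr0n (side_r_gt0 sA).
  have rp' : 0 < (r' u.2)%:R :> R by rewrite ltr0n (side_r_gt0 sB).
  have -> : phi u.1 * x u.1 * al u.1 u.2 * (phi' u.2 * y u.2 * be u.1 u.2) =
     (phi u.1 * x u.1 * (phi' u.2 * y u.2)) ^+ 2 *
      (H ^+ (omega_in (r u.1) + omega_in (r' u.2))).
    by rewrite /al /be exprD; field; rewrite !gt_eqF.
  have t0 : 0 <= phi u.1 * x u.1 * (phi' u.2 * y u.2) by rewrite !mulr_ge0.
  rewrite powRM ?sqr_ge0 ?exprn_ge0 ?(ltW H0)// powR_sqr_half// mulrC ler_wpM2l//.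
  rewrite -powR_mulrn ?(ltW H0)// -powRrM; apply: ler_powR => //.
  rewrite mulrA mulr1 ler_pM2r ?invr_gt0//.
  by have [] := E1 _ _ Au Bu Eu.
have Hs : H `^ (1 - s) = expR (C * s).
  by rewrite /H -expRM -!mulrA mulVf ?mulr1//; rewrite subr_eq0 eq_sym lt_eqF//; move: (s_le); lra.
set G := cA * cB / l ^+ 2; have G0 : 0 <= G by rewrite /G !mulr_ge0// invr_ge0 sqr_ge0.
have s1 : 0 <= 2 * s - 1 by move: (s_gt); lra.
have s2 : 0 < 2 * (1 - s) by move: (s_le); lra.
have XY0 : 0 <= X * Y by rewrite mulr_ge0.
have [XYe|XYn] := eqVneq (X * Y) 0.
  have -> : tot = 0 by apply/eqP; rewrite eq_le tot0 andbT -XYe edge_mass_le.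
  by rewrite !mulr_ge0 ?powR_ge0 ?expR_ge0.
have half' : tot <= omega_mean * (G * (X * Y)) `^ (1 / 2) * H `^ (- (K / 2)).
  by rewrite powRN ler_pdivlMr ?powR_gt0// mulrC.
have XYp : 0 < X * Y by rewrite lt_neqAle eq_sym XYn.
(* Interpolation: the trivial bound [X * Y] with exponent [2 s - 1], the Cauchy-Schwarz bound with
   exponent [2 (1 - s)]. *)
have -> : tot = tot `^ (2 * s - 1) * tot `^ (2 * (1 - s)).
  have es : 2 * s - 1 + 2 * (1 - s) = 1 by ring.
  by rewrite -powRD es ?powRr1// oner_eq0.
have q1 : tot `^ (2 * s - 1) <= (X * Y) `^ (2 * s - 1).
  by apply: le_powR => //; exact: edge_mass_le.
have q2 := le_powR (ltW s2) tot0 half'.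
apply: le_trans (ler_pM (powR_ge0 _ _) (powR_ge0 _ _) q1 q2) _.
have MG0 : 0 <= omega_mean * (G * (X * Y)) `^ (1 / 2) by rewrite mulr_ge0// powR_ge0.
rewrite (powRM _ MG0 (powR_ge0 _ _)) (powRM _ M0 (powR_ge0 _ _)) -!powRrM.
have -> : 1 / 2 * (2 * (1 - s)) = 1 - s by field.
have -> : H `^ (- (K / 2) * (2 * (1 - s))) = expR (- (C * K * s)).
  rewrite (_ : - (K / 2) * (2 * (1 - s)) = (1 - s) * (- K)); last by field.
  by rewrite powRrM Hs -expRM; congr expR; ring.
have -> : (X * Y) `^ s = (X * Y) `^ (2 * s - 1) * (X * Y) `^ (1 - s).
  by rewrite -powRDpos//; congr (_ `^ _); ring.
rewrite (powRM _ G0 XY0) le_eqVlt; apply/orP; left; apply/eqP; ring.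
Qed.

(** * Removing one prime from the vertices *)

Definition free_part (p n : nat) : nat := (n %/ p ^ logn p n)%N.

Lemma free_partP p n : prime p -> (0 < n)%N ->
  [/\ n = (free_part p n * p ^ logn p n)%N, coprime p (free_part p n) &
      (0 < free_part p n)%N].
Proof.
move=> pp n0; have [m pm nE] := pfactor_coprime pp n0.
have p0 : (0 < p ^ logn p n)%N by rewrite expn_gt0 prime_gt0.
have -> : free_part p n = m by rewrite /free_part {1}nE mulnK.
split=> //; move: n0; rewrite nE muln_gt0; by case/andP.
Qed.

Lemma logn_free_part p q n : prime p -> prime q -> q != p -> (0 < n)%N ->
  logn q (free_part p n) = logn q n.
Proof.
move=> pp qp qnp n0; have [nE _ m0] := free_partP pp n0.
rewrite {2}nE lognM ?m0 ?expn_gt0 ?(prime_gt0 pp)//.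
by rewrite lognX (logn_prime q pp) (negPf qnp) muln0 addn0.
Qed.

(** Of [p^e] the part [p^kA] goes into the constant and [p^(e - kA)] into [r]. The vertex can still
    be recovered: [p] divides no old [r], so [e - kA] is the exponent of [p] in the new one. *)
Lemma side_box (w : nat -> R) (V : finType) (ph : V -> R) p L (A : pred V) r o c
    (SA : pred nat) kA (al : R) :
  prime p -> p \notin L -> all prime L ->
  mult_fun w -> (forall n, (0 < n)%N -> 0 <= w n) -> 0 <= al ->
  (forall e, SA e -> (kA <= e)%N) ->
  (forall e, SA e -> w (p ^ e)%N <= al * (p ^ e)%:R) ->
  side w ph (p :: L) A r o c ->
  side w ph L (fun i => A i && SA (logn p (o i)))
    (fun i => r i * p ^ (logn p (o i) - kA))%N (fun i => free_part p (o i))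
    (c * (al * (p ^ kA)%:R)).
Proof.
move=> pp pL Lp [w1 wM] w0 al0 kle wle [c0 r0 o0 cop supp wt inj]; split.
- by rewrite !mulr_ge0.
- by move=> i /andP[Ai _]; rewrite muln_gt0 r0//= expn_gt0 prime_gt0.
- by move=> i /andP[Ai _]; have [] := free_partP pp (o0 i Ai).
- move=> i q /andP[Ai _] qL; have qp : prime q := allP Lp q qL.
  rewrite Euclid_dvdM// negb_or cop ?inE ?qL ?orbT//=.
  apply/negP; rewrite Euclid_dvdX// => /andP[]; rewrite dvdn_prime2// => /eqP qp' _.
  by move: pL; rewrite -qp' qL.
- move=> i q /andP[Ai _] qp qd; have [oE copr _] := free_partP pp (o0 i Ai).
  have : q \in p :: L by apply: (supp i) => //; rewrite oE dvdn_mulr.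
  rewrite inE => /orP[/eqP qp'|//]; move: copr.
  by rewrite prime_coprime// -{1}qp' qd.
- move=> i /andP[Ai Si]; have [oE copr m0] := free_partP pp (o0 i Ai).
  set e := logn p (o i) in oE Si *; set m := free_part p (o i) in oE copr m0 *.
  have pe0 : (0 < p ^ e)%N by rewrite expn_gt0 prime_gt0.
  have := wt i Ai; rewrite oE wM//; last by rewrite coprime_sym coprimeXl.
  move=> /le_trans; apply.
  have cr : 0 <= c * (r i)%:R by rewrite mulr_ge0.
  apply: (@le_trans _ _ (c * (r i)%:R * (w m * (al * (p ^ e)%:R)))).
    by rewrite ler_wpM2l// ler_wpM2l ?wle ?w0.
  have -> : (p ^ e = p ^ (e - kA) * p ^ kA)%N by rewrite -expnD subnK// kle.
  rewrite !natrM le_eqVlt; apply/orP; left; apply/eqP; ring.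
- move=> i i' /andP[Ai Si] /andP[Ai' Si'] rE mE.
  have [oE _ _] := free_partP pp (o0 i Ai); have [oE' _ _] := free_partP pp (o0 i' Ai').
  have lr k : A k -> logn p (r k) = 0%N.
    by move=> Ak; apply: logn_coprime; rewrite prime_coprime// cop// mem_head.
  have le : (logn p (o i) - kA = logn p (o i') - kA)%N.
    have := congr1 (logn p) rE; rewrite !lognM ?r0 ?expn_gt0 ?(prime_gt0 pp)//.
    by rewrite !lr// !add0n !pfactorK.
  have ee : logn p (o i) = logn p (o i').
    by rewrite -(subnK (kle _ Si)) -(subnK (kle _ Si')) le.
  apply: inj => //; last by rewrite oE oE' mE ee.
  have pe0 : (0 < p ^ (logn p (o i') - kA))%N by rewrite expn_gt0 prime_gt0.
  by move: rE; rewrite le => /eqP; rewrite eqn_pmul2r// => /eqP.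
Qed.

Lemma omega_in_mul p r m : prime p -> ~~ (p %| r)%N -> (T p -> p \in Q) ->
  (omega_in r + (T p && (0 < m)) <= omega_in (r * p ^ m))%N.
Proof.
move=> pp pr TQ; rewrite /omega_in.
have sub q : (q %| r)%N -> (q %| r * p ^ m)%N by move=> /dvdn_mulr.
case: (boolP (T p && (0 < m)%N)) => [/andP[Tp m0]|_]; last first.
  by rewrite addn0; apply: sub_count.
have pQ := TQ Tp.
have c1 : (1 <= count (pred1 p) Q)%N by rewrite -has_count has_pred1.
apply: leq_trans (leq_add (leqnn _) c1) _.
rewrite -(count_predUI (fun q => q %| r)%N (pred1 p)).
rewrite [X in (_ + X)%N](_ : _ = 0%N) ?addn0.
  apply: sub_count => q /= /orP[/sub //|/eqP ->].
  by rewrite dvdn_mull// -{1}(expn1 p) dvdn_exp2l.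
apply/eqP; rewrite -leqn0 leqNgt -has_count; apply/hasPn => q _ /=.
by apply/negP => /andP[qr /eqP qp]; move: pr; rewrite -qp qr.
Qed.

Lemma lcmn_free_part p m n : prime p -> (0 < m)%N -> (0 < n)%N ->
  (p ^ maxn (logn p m) (logn p n) * lcmn (free_part p m) (free_part p n) <= lcmn m n)%N.
Proof.
move=> pp m0 n0; have [mE cm fm0] := free_partP pp m0; have [nE cn fn0] := free_partP pp n0.
apply: dvdn_leq; first by rewrite lcmn_gt0 m0.
rewrite Gauss_dvd; last first.
  rewrite coprimeXl// prime_coprime//; apply/negP => pd.
  have : (p %| free_part p m * free_part p n)%N.
    by apply: dvdn_trans pd _; rewrite dvdn_lcm dvdn_mulr// dvdn_mull.
  by rewrite Euclid_dvdM// => /orP[]; apply/negP; rewrite -prime_coprime.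
apply/andP; split.
  rewrite /maxn; case: ifP => _.
    by apply: dvdn_trans (dvdn_lcmr m n); rewrite {2}nE dvdn_mull.
  by apply: dvdn_trans (dvdn_lcml m n); rewrite {2}mE dvdn_mull.
rewrite dvdn_lcm; apply/andP; split.
  by apply: dvdn_trans (dvdn_lcml m n); rewrite {2}mE dvdn_mulr.
by apply: dvdn_trans (dvdn_lcmr m n); rewrite {2}nE dvdn_mulr.
Qed.

(** The first condition on [Z] makes the powers of [p] put into [l], [r] and [r'] fit into the least
    common multiple. The second keeps track of a difference of exponents: it is counted by
    [omega_in] of a new part, or else by [d], at the price of lowering [K] by [1] for [p] in [T]. *)
Lemma edges_box p L A B E r o r' o' cA cB l K (SA SB : pred nat) (Z : rel nat)
    kA kB m0 (d : bool) :
  prime p -> p \notin L -> all prime L -> (T p -> p \in Q) -> 0 < l ->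
  side f phi (p :: L) A r o cA -> side g phi' (p :: L) B r' o' cB ->
  (forall e e', SA e -> SB e' -> Z e e' ->
     (m0 + (e - kA) + (e' - kB) <= maxn e e')%N /\
     ((e != e') <= d + (kA < e) + (kB < e'))%N) ->
  edges (p :: L) A B E r o r' o' l K ->
  edges L (fun i => A i && SA (logn p (o i))) (fun j => B j && SB (logn p (o' j)))
    (fun i j => E i j && Z (logn p (o i)) (logn p (o' j)))
    (fun i => r i * p ^ (logn p (o i) - kA))%N (fun i => free_part p (o i))
    (fun j => r' j * p ^ (logn p (o' j) - kB))%N (fun j => free_part p (o' j))
    (l * (p ^ m0)%:R) (K - (T p && d)%:R).
Proof.
move=> pp pL Lp TQ l0 sA sB hZ hE i j /andP[Ai Si] /andP[Bj Sj] /andP[Eij Zij].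
have [h1 h2 h3] := hE i j Ai Bj Eij.
have [z1 z2] := hZ _ _ Si Sj Zij.
have oi0 := side_o_gt0 sA Ai; have oj0 := side_o_gt0 sB Bj.
set e := logn p (o i) in z1 z2 *; set e' := logn p (o' j) in z1 z2 *.
have len : l * (p ^ m0)%:R *
  (r i * p ^ (e - kA) * (r' j * p ^ (e' - kB)) *
     lcmn (free_part p (o i)) (free_part p (o' j)))%:R <=
  l * (r i * r' j * lcmn (o i) (o' j))%:R.
  rewrite -mulrA -natrM ler_pM2l// ler_nat.
  have -> : (p ^ m0 * (r i * p ^ (e - kA) * (r' j * p ^ (e' - kB)) *
     lcmn (free_part p (o i)) (free_part p (o' j))) =
     r i * r' j * (p ^ (m0 + (e - kA) + (e' - kB)) *
     lcmn (free_part p (o i)) (free_part p (o' j))))%N.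
    by rewrite !expnD; ring.
  rewrite leq_mul2l; apply/orP; right; apply: leq_trans (lcmn_free_part pp oi0 oj0).
  by rewrite leq_mul2r leq_pexp2l ?prime_gt0// orbT.
split.
- by apply: le_trans h1; rewrite ler_wpM2l.
- by apply: le_trans h2; rewrite ler_wpM2l.
- rewrite lerBlDr -natrD; apply: le_trans h3 _; rewrite ler_nat.
  have pr : ~~ (p %| r i)%N by apply: (side_coprime sA) => //; exact: mem_head.
  have pr' : ~~ (p %| r' j)%N by apply: (side_coprime sB) => //; exact: mem_head.
  have w1 := omega_in_mul (e - kA) pp pr TQ; have w2 := omega_in_mul (e' - kB) pp pr' TQ.
  have -> : exp_diff (p :: L) (o i) (o' j) =
     ((T p && (e != e')) + exp_diff L (free_part p (o i)) (free_part p (o' j)))%N.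
    rewrite /exp_diff /=; congr (_ + _)%N; apply: eq_in_count => q qL.
    have qp : prime q := allP Lp q qL.
    have qnp : q != p by apply: contra pL => /eqP <-.
    by rewrite !logn_free_part.
  rewrite !subn_gt0 in w1 w2.
  move: w1 w2 z2; clear; case: (T p) => /=; lia.
Qed.

Lemma bounded_box p L M A B E r o r' o' cA cB l K (SA SB : pred nat) (Z : rel nat)
    kA kB m0 (d : bool) (al be : R) :
  bounded L M -> mult_fun f -> mult_fun g ->
  (forall n, (0 < n)%N -> 0 <= f n) -> (forall n, (0 < n)%N -> 0 <= g n) ->
  prime p -> p \notin L -> all prime L -> (T p -> p \in Q) -> 0 < l ->
  0 <= al -> 0 <= be ->
  (forall e, SA e -> (kA <= e)%N) -> (forall e, SB e -> (kB <= e)%N) ->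
  (forall e, SA e -> f (p ^ e)%N <= al * (p ^ e)%:R) ->
  (forall e, SB e -> g (p ^ e)%N <= be * (p ^ e)%:R) ->
  side f phi (p :: L) A r o cA -> side g phi' (p :: L) B r' o' cB ->
  (forall e e', SA e -> SB e' -> Z e e' ->
     (m0 + (e - kA) + (e' - kB) <= maxn e e')%N /\
     ((e != e') <= d + (kA < e) + (kB < e'))%N) ->
  edges (p :: L) A B E r o r' o' l K ->
  edge_mass (fun i => A i && SA (logn p (o i))) (fun j => B j && SB (logn p (o' j)))
    (fun i j => E i j && Z (logn p (o i)) (logn p (o' j))) <=
  M * ((cA * (al * (p ^ kA)%:R)) * (cB * (be * (p ^ kB)%:R)) / (l * (p ^ m0)%:R) ^+ 2) `^ (1 - s) *
  (mass phi x (fun i => A i && SA (logn p (o i))) *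
   mass phi' y (fun j => B j && SB (logn p (o' j)))) `^ s *
  expR (- (C * (K - (T p && d)%:R) * s)).
Proof.
move=> bL mf mg f0 g0 pp pL Lp TQ l0 al0 be0 kA_le kB_le fle gle sA sB hZ hE.
apply: (bL _ _ _ _ _ _ _ _ _ _ _ _ (side_box pp pL Lp mf f0 al0 kA_le fle sA)
  (side_box pp pL Lp mg g0 be0 kB_le gle sB)
  (edges_box pp pL Lp TQ l0 sA sB hZ hE)).
by rewrite mulr_gt0// ltr0n expn_gt0 prime_gt0.
Qed.

(** * Splitting by exponents and the induction step *)

Lemma sum_by_exponent (V : finType) (D : pred V) (e : V -> nat) (F : V -> R) n :
  (forall v, e v < n)%N ->
  \sum_(v | D v) F v = \sum_(i < n) \sum_(v | D v && (e v == i)) F v.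
Proof.
by move=> en; rewrite (partition_big (fun v => Ordinal (en v)) xpredT).
Qed.

(** The pairs in [Z] stay together, every other pair of exponents is a class of its own; [&& true]
    gives these classes the shape of [bounded_box]. *)
Lemma edge_mass_split (A : pred I) (B : pred J) E (Z : rel nat) (e : I -> nat)
    (e' : J -> nat) n : (forall i, e i < n)%N -> (forall j, e' j < n)%N ->
  edge_mass A B E = edge_mass A B (fun i j => E i j && Z (e i) (e' j)) +
    \sum_(a < n) \sum_(b < n) (if Z a b then 0 else
      edge_mass (fun i => A i && (e i == a)) (fun j => B j && (e' j == b))
        (fun i j => E i j && true)).
Proof.
move=> en en'; rewrite {1}/edge_mass (bigID (fun u : I * J => Z (e u.1) (e' u.2)))/=.
congr (_ + _).
  by apply: eq_bigl => u; rewrite -!andbA.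
rewrite (sum_by_exponent _ _ (fun u : I * J => en u.1)); apply: eq_bigr => a _.
rewrite (sum_by_exponent _ _ (fun u : I * J => en' u.2)); apply: eq_bigr => b _.
case: ifP => hZ.
  rewrite big_pred0// => u; apply/negP => /andP[/andP[/andP[_ zn] /eqP ea] /eqP eb].
  by move: zn; rewrite ea eb hZ.
apply: eq_bigl => u /=; rewrite andbT.
case: (A u.1) => //=; case: (B u.2) => //=; case: (E u.1 u.2); rewrite ?andbF//= ?andbT.
case: eqP => [->|]; rewrite ?andbF//=; case: eqP => [->|]; rewrite ?andbF//=.
by rewrite hZ.
Qed.

Definition exp_weight (w : nat -> R) (p i : nat) : R := w (p ^ i)%N / (p ^ i)%:R.

(** Growth of [e^(- C K s)] when [K] drops by [1], which happens only for primes in [T]. *)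
Definition ndiff_weight (p : nat) : R := if T p then expR (C * s) else 1.

(** The alternative of [local_large] under one bound [S]: all classes are treated separately, or the
    tame pairs of some [k] form a single class with weights at most [a] and [b]. *)
Definition local_ok (p : nat) (S : R) : Prop :=
  forall n (al be : nat -> R), (forall i, 0 <= al i) -> (forall i, 0 <= be i) ->
  \sum_(i < n) al i = 1 -> \sum_(i < n) be i = 1 ->
  let t := local_term s (ndiff_weight p) p%:R (exp_weight f p) (exp_weight g p) al be in
  \sum_(i < n) \sum_(j < n) t i j <= S \/
  exists k (a b : R), [/\ (0 <= a) && (0 <= b),
    forall i, tame_exp k i -> exp_weight f p i <= a,
    forall i, tame_exp k i -> exp_weight g p i <= b &
    \sum_(i < n) \sum_(j < n) (if tame_pair k i j then 0 else t i j) +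
    (a * b) `^ (1 - s) *
    ((\sum_(i < n | tame_exp k i) al i) * (\sum_(i < n | tame_exp k i) be i)) `^ s <= S].

(** The conditions of [edges_box] for [kA = kB = m0 = k] and [d = false]: since one exponent equals
    [k], at most one side keeps a factor [p], and [omega_in] counts it. *)
Lemma tame_exponents k e e' : tame_exp k e -> tame_exp k e' -> (e == k) || (e' == k) ->
  (k + (e - k) + (e' - k) <= maxn e e')%N /\ ((e != e') <= false + (k < e) + (k < e'))%N.
Proof. by rewrite /tame_exp => *; split; lia. Qed.

Lemma ndist_max i j : (i + j + ndist i j = (maxn i j).*2)%N.
Proof. by rewrite /ndist; lia. Qed.

Lemma bounded_cons p L M S :
  bounded L M -> 0 <= M -> 0 <= S -> local_ok p S -> mult_fun f -> mult_fun g ->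
  (forall n, (0 < n)%N -> 0 <= f n) -> (forall n, (0 < n)%N -> 0 <= g n) ->
  prime p -> p \notin L -> all prime L -> (T p -> p \in Q) ->
  bounded (p :: L) (M * S).
Proof.
move=> bL M0 S0 loc mf mg f0 g0 pp pL Lp TQ A B E r o r' o' cA cB l K l0 sA sB hE.
set X := mass phi x A; set Y := mass phi' y B.
have X0 : 0 <= X by exact: mass_ge0.
have Y0 : 0 <= Y by exact: mass_ge0.
have [XYe|XYn] := eqVneq (X * Y) 0.
  apply: le_trans (edge_mass_le A B E) _; rewrite -/X -/Y XYe.
  by rewrite !mulr_ge0 ?powR_ge0 ?expR_ge0.
move: XYn; rewrite mulf_eq0 negb_or => /andP[Xn Yn].
set G := cA * cB / l ^+ 2.
have cA0 := side_ge0 sA; have cB0 := side_ge0 sB.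
have G0 : 0 <= G by rewrite /G !mulr_ge0// invr_ge0 sqr_ge0.
pose e i := logn p (o i); pose e' j := logn p (o' j).
pose n := (\max_i e i + \max_j e' j).+1.
have en i : (e i < n)%N by rewrite ltnS; apply: leq_trans (leq_addr _ _); exact: leq_bigmax.
have en' j : (e' j < n)%N by rewrite ltnS; apply: leq_trans (leq_addl _ _); exact: leq_bigmax.
pose Am a := mass phi x (fun i => A i && (e i == a)).
pose Bm b := mass phi' y (fun j => B j && (e' j == b)).
pose al a := Am a / X; pose be b := Bm b / Y.
have al0 a : 0 <= al a by rewrite divr_ge0// mass_ge0.
have be0 b : 0 <= be b by rewrite divr_ge0// mass_ge0.
have al1 : \sum_(a < n) al a = 1.
  by rewrite -mulr_suml /Am /mass -(sum_by_exponent A _ en) divff.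
have be1 : \sum_(b < n) be b = 1.
  by rewrite -mulr_suml /Bm /mass -(sum_by_exponent B _ en') divff.
pose W := M * G `^ (1 - s) * (X * Y) `^ s * expR (- (C * K * s)).
have W0 : 0 <= W by rewrite !mulr_ge0 ?powR_ge0 ?expR_ge0.
have p0 : (0 < p)%N by exact: prime_gt0.
have pk0 k : (p ^ k)%:R != 0 :> R by rewrite pnatr_eq0 -lt0n expn_gt0 p0.
have wle (w : nat -> R) k : w (p ^ k)%N <= exp_weight w p k * (p ^ k)%:R.
  by rewrite /exp_weight divfK.
have ew0 (w : nat -> R) k : (forall n, (0 < n)%N -> 0 <= w n) -> 0 <= exp_weight w p k.
  by move=> w0; rewrite divr_ge0// w0// expn_gt0 p0.
set t := local_term s (ndiff_weight p) p%:R (exp_weight f p) (exp_weight g p) al be.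
have split_le a b : edge_mass (fun i => A i && (e i == a)) (fun j => B j && (e' j == b))
    (fun i j => E i j && true) <= W * t a b.
  have hZ u v : pred1 a u -> pred1 b v -> true ->
    (maxn a b + (u - a) + (v - b) <= maxn u v)%N /\
    ((u != v) <= (a != b) + (a < u) + (b < v))%N.
    by move=> /eqP -> /eqP -> _; rewrite !subnn !addn0 leqnn !ltnn !addn0.
  have ka u : pred1 a u -> (a <= u)%N by move=> /eqP ->.
  have kb u : pred1 b u -> (b <= u)%N by move=> /eqP ->.
  have fa u : pred1 a u -> f (p ^ u)%N <= exp_weight f p a * (p ^ u)%:R by move=> /eqP ->.
  have gb u : pred1 b u -> g (p ^ u)%N <= exp_weight g p b * (p ^ u)%:R by move=> /eqP ->.
  apply: le_trans (bounded_box (Z := fun _ _ => true) bL mf mg f0 g0 pp pL Lp TQ l0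
    (ew0 f a f0) (ew0 g b g0) ka kb fa gb sA sB hZ hE) _.
  rewrite -/(Am a) -/(Bm b).
  (* The kernel of [local_term] arises from [p^a p^b / p^(2 max(a, b)) = p^(-|a - b|)]. *)
  have -> : cA * (exp_weight f p a * (p ^ a)%:R) * (cB * (exp_weight g p b * (p ^ b)%:R)) /
     (l * (p ^ maxn a b)%:R) ^+ 2 =
     G * (exp_weight f p a * exp_weight g p b / p%:R ^+ ndist a b).
    have : ((p ^ a)%:R * (p ^ b)%:R * p%:R ^+ ndist a b = (p ^ maxn a b)%:R ^+ 2 :> R).
      by rewrite -!natrX -!natrM -!expnD ndist_max -expnM muln2.
    have : p%:R ^+ ndist a b != 0 :> R by rewrite expf_neq0// pnatr_eq0 -lt0n.
    move=> nz eq; rewrite exprMn -eq /G; field.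
    by rewrite nz !pk0 gt_eqF.
  have -> : Am a * Bm b = X * Y * (al a * be b) by rewrite /al /be; field; rewrite Xn Yn.
  rewrite (powRM _ G0); last by rewrite divr_ge0 ?exprn_ge0// mulr_ge0// ew0.
  rewrite (powRM _ (mulr_ge0 X0 Y0)); last by rewrite mulr_ge0.
  have -> : expR (- (C * (K - (T p && (a != b))%:R) * s)) =
     expR (- (C * K * s)) * (if a == b then 1 else ndiff_weight p).
    rewrite /ndiff_weight; case: eqP => _; rewrite ?andbF ?andbT ?subr0 ?mulr1//=.
    by case: (T p) => /=; rewrite ?mulr0n ?subr0 ?mulr1// -expRD; congr expR; ring.
  rewrite /W /t /local_term le_eqVlt; apply/orP; left; apply/eqP; ring.
have nonneg Z : \sum_(a < n) \sum_(b < n) (if Z a b then 0 else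
    edge_mass (fun i => A i && (e i == a)) (fun j => B j && (e' j == b))
        (fun i j => E i j && true)) <=
    W * \sum_(a < n) \sum_(b < n) (if Z a b then 0 else t a b) :> R.
  rewrite mulr_sumr; apply: ler_sum => a _; rewrite mulr_sumr; apply: ler_sum => b _.
  by case: ifP => _; rewrite ?mulr0.
have -> : M * S * G `^ (1 - s) * (X * Y) `^ s * expR (- (C * K * s)) = W * S.
  by rewrite /W; ring.
have [full|[k [a [b [/andP[a0 b0] fa gb tame]]]]] := loc n al be al0 be0 al1 be1.
  rewrite (edge_mass_split A B E (fun _ _ => false) en en').
  rewrite [X in X + _ <= _](_ : _ = 0); last first.
    by rewrite /edge_mass big_pred0// => u; rewrite !andbF.
  rewrite add0r; apply: le_trans (nonneg (fun _ _ => false)) _.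
  by rewrite ler_wpM2l.
rewrite (edge_mass_split A B E (tame_pair k) en en') addrC.
apply: le_trans (ler_wpM2l W0 tame); rewrite mulrDr; apply: lerD; first exact: nonneg.
have ka u : tame_exp k u -> (k <= u)%N by move=> /orP[/eqP -> //|/eqP ->].
have fa' u : tame_exp k u -> f (p ^ u)%N <= a * (p ^ u)%:R.
  by move=> /fa h; apply: le_trans (wle f u) _; rewrite ler_wpM2r.
have gb' u : tame_exp k u -> g (p ^ u)%N <= b * (p ^ u)%:R.
  by move=> /gb h; apply: le_trans (wle g u) _; rewrite ler_wpM2r.
have := bounded_box (Z := fun u v => (u == k) || (v == k)) bL mf mg f0 g0 pp pL Lp TQ l0
    a0 b0 ka ka fa' gb' sA sB (@tame_exponents k) hE.
rewrite andbF subr0.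
have -> : cA * (a * (p ^ k)%:R) * (cB * (b * (p ^ k)%:R)) / (l * (p ^ k)%:R) ^+ 2 = G * (a * b).
  by rewrite /G; field; rewrite !pk0 gt_eqF.
have -> : mass phi x (fun i => A i && tame_exp k (logn p (o i))) =
    X * \sum_(i < n | tame_exp k i) al i.
  rewrite -mulr_suml mulrC divfK// /Am /mass (sum_by_exponent _ _ en) [RHS]big_mkcond/=.
  apply: eq_bigr => i _; case: ifP => hi.
    by apply: eq_bigl => v; rewrite -andbA; case: (A v) => //=; rewrite -/(e v); case: eqP => [->|]; rewrite ?hi ?andbF.
  by rewrite big_pred0// => v; rewrite -/(e v); case: eqP => [->|]; rewrite ?hi ?andbF.
have -> : mass phi' y (fun j => B j && tame_exp k (logn p (o' j))) =
    Y * \sum_(i < n | tame_exp k i) be i.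
  rewrite -mulr_suml mulrC divfK// /Bm /mass (sum_by_exponent _ _ en') [RHS]big_mkcond/=.
  apply: eq_bigr => i _; case: ifP => hi.
    by apply: eq_bigl => v; rewrite -andbA; case: (B v) => //=; rewrite -/(e' v); case: eqP => [->|]; rewrite ?hi ?andbF.
  by rewrite big_pred0// => v; rewrite -/(e' v); case: eqP => [->|]; rewrite ?hi ?andbF.
have al_ge0 : 0 <= \sum_(i < n | tame_exp k i) al i by exact: sumr_ge0.
have be_ge0 : 0 <= \sum_(i < n | tame_exp k i) be i by exact: sumr_ge0.
rewrite (powRM _ G0); last by rewrite mulr_ge0.
rewrite (mulrACA X) (powRM _ (mulr_ge0 X0 Y0)); last by rewrite mulr_ge0.
move=> h; apply: le_trans (le_trans h _).
  rewrite le_eqVlt; apply/orP; left; apply/eqP; apply: eq_bigl => u /=.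
  rewrite /tame_pair -/(e u.1) -/(e' u.2).
  by case: (A u.1); case: (B u.2); case: (E u.1 u.2); rewrite ?andbF//=.
by rewrite /W le_eqVlt; apply/orP; left; apply/eqP; ring.
Qed.

End States.

(** * Assembling the local bounds *)

Section FiniteSums.
Variable R : realType.

Lemma fsbig_finType (T : choiceType) (K : finType) (h : K -> T) (D : set T) (F : T -> R) :
  injective h -> (forall x, D x -> exists k, h k = x) ->
  \sum_(x \in D) F x = \sum_(k | `[< D (h k) >]) F (h k).
Proof.
move=> h_inj hD.
have Dfin : finite_set D.
  apply: (@sub_finite_set _ _ [set` [seq h k | k <- enum K]]); last exact: finite_seq.
  by move=> x /hD[k <-] /=; apply: map_f; rewrite mem_enum.
rewrite fsbig_finite//=.
have -> : \sum_(k | `[< D (h k) >]) F (h k) =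
    \sum_(x <- [seq h k | k <- enum [pred k | `[< D (h k) >]]]) F x.
  by rewrite big_map big_enum.
apply: perm_big; apply: uniq_perm.
- exact: finmap.fset_uniq.
- by rewrite map_inj_uniq// enum_uniq.
move=> x; rewrite in_fset_set//; apply/idP/idP.
  rewrite inE => Dx; have [k hk] := hD x Dx.
  by rewrite -hk; apply: map_f; rewrite mem_enum; apply/asboolP; rewrite hk.
move=> /mapP[k]; rewrite mem_enum => /asboolP Dk ->.
by rewrite inE.
Qed.

Lemma rcard_size (D : set nat) : finite_set D ->
  rcard R D = (size (finmap.enum_fset (fset_set D)))%:R.
Proof.
by move=> fD; rewrite /rcard fsbig_finite//= big_const_seq count_predT iter_addr_0.
Qed.

Lemma rcard_le_size (D : set nat) (l : seq nat) :
  (forall p, D p -> p \in l) -> rcard R D <= (size l)%:R.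
Proof.
move=> Dl; have fD : finite_set D.
  by apply: (@sub_finite_set _ _ [set` l]); [move=> p /Dl|exact: finite_seq].
rewrite rcard_size// ler_nat; apply: uniq_leq_size; first exact: finmap.fset_uniq.
by move=> p; rewrite in_fset_set// inE => /Dl.
Qed.

Lemma size_le_rcard (D : set nat) (l : seq nat) : finite_set D -> uniq l ->
  (forall p, p \in l -> D p) -> (size l)%:R <= rcard R D.
Proof.
move=> fD ul lD; rewrite rcard_size// ler_nat; apply: uniq_leq_size => // p /lD Dp.
by rewrite in_fset_set// inE.
Qed.

Lemma finite_set_bounded (D : set nat) : finite_set D ->
  exists N, forall n, D n -> (n < N)%N.
Proof.
move=> fD; exists (\max_(n <- finmap.enum_fset (fset_set D)) n).+1 => n Dn.
rewrite ltnS (big_rem n)/= ?leq_maxl//.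
by rewrite in_fset_set// inE.
Qed.

(** The exponent of [p] in the quotient is the sum of the two exponents minus twice their minimum,
    which is zero when they agree. *)
Lemma dvdn_lcm_gcd_logn p v w : prime p -> (0 < v)%N -> (0 < w)%N ->
  (p %| (v * w) %/ gcdn v w ^ 2)%N -> logn p v != logn p w.
Proof.
move=> pp v0 w0; have g0 : (0 < gcdn v w)%N by rewrite gcdn_gt0 v0.
have gd : (gcdn v w ^ 2 %| v * w)%N by rewrite -mulnn dvdn_mul ?dvdn_gcdl ?dvdn_gcdr.
have q0 : (0 < (v * w) %/ gcdn v w ^ 2)%N.
  by rewrite divn_gt0 ?expn_gt0 ?g0// dvdn_leq// muln_gt0 v0.
rewrite -{1}(expn1 p) pfactor_dvdn// logn_div// lognM// lognX logn_gcd//.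
move: (logn p v) (logn p w); clear => a b; lia.
Qed.

End FiniteSums.

(** * Local weights from the bound on divisor sums *)

Section LocalBounds.
Variables (R : realType) (w : nat -> R).
Hypotheses (w_ge0 : forall n, (0 < n)%N -> 0 <= w n)
  (w_conv : forall n, (0 < n)%N -> one_conv w n <= n%:R).

Lemma sub_divisors_le n (l : seq nat) : (0 < n)%N -> uniq l ->
  all (fun d => d %| n)%N l -> \sum_(d <- l) w d <= n%:R.
Proof.
move=> n0 ul dl; apply: le_trans (w_conv n0); apply: sum_uniq_subset => //.
  by move=> d dn; rewrite -dvdn_divisors// (allP dl).
move=> d; rewrite -dvdn_divisors// => dn; apply: w_ge0.
exact: dvdn_gt0 dn.
Qed.

Lemma exp_weight01 p : prime p -> forall i, 0 <= exp_weight w p i <= 1.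
Proof.
move=> pp i; have pi0 : (0 < p ^ i)%N by rewrite expn_gt0 prime_gt0.
rewrite /exp_weight divr_ge0 ?w_ge0//= ler_pdivrMr ?ltr0n// mul1r.
have := @sub_divisors_le _ [:: (p ^ i)%N] pi0 isT; rewrite /= dvdnn big_seq1.
exact.
Qed.

(** Of the divisors of [p^(i+1)] only [p^(i+1)] and [p^i] are kept in the convolution bound, which
    is then divided by [p^(i+1)]. *)
Lemma exp_weight_succ p : prime p -> forall i,
  exp_weight w p i.+1 + exp_weight w p i / p%:R <= 1.
Proof.
move=> pp i; have p0 : (0 < p)%N by exact: prime_gt0.
have pi0 : (0 < p ^ i)%N by rewrite expn_gt0 p0.
have pi1 : (0 < p ^ i.+1)%N by rewrite expn_gt0 p0.
have := @sub_divisors_le _ [:: (p ^ i.+1)%N; (p ^ i)%N] pi1.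
rewrite /= !inE dvdnn dvdn_exp2l// andbT eqn_exp2l ?prime_gt1// -(inj_eq succn_inj).
rewrite gtn_eqF//= big_cons big_seq1 => /(_ isT isT) h.
have -> : exp_weight w p i.+1 + exp_weight w p i / p%:R =
   (w (p ^ i.+1)%N + w (p ^ i)%N) / (p ^ i.+1)%:R.
  rewrite /exp_weight -mulrA -invfM mulrDl; congr (_ + _ / _).
  by rewrite -natrM expnSr.
by rewrite ler_pdivrMr ?ltr0n// mul1r.
Qed.

End LocalBounds.

(** * The product over all primes and its constants *)

Section Assembly.
Variable R : realType.
Implicit Types (s C : R) (f g : nat -> R).

Lemma ndiff_weight_ge1 s C (T : pred nat) p : 0 <= s -> 0 <= C ->
  1 <= ndiff_weight s C T p.
Proof.
move=> s0 C0; rewrite /ndiff_weight; case: (T p) => //.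
by rewrite -[leLHS]expR0 ler_expR mulr_ge0.
Qed.

Lemma local_ok_all s C f g (T : pred nat) p : 1 / 2 < s -> s <= 9 / 10 -> 0 < C ->
  (forall n, (0 < n)%N -> 0 <= f n) -> (forall n, (0 < n)%N -> 0 <= g n) ->
  (forall n, (0 < n)%N -> one_conv f n <= n%:R) ->
  (forall n, (0 < n)%N -> one_conv g n <= n%:R) ->
  prime p -> local_ok s C f g T p (100 * expR C).
Proof.
move=> s1 s2 C0 f0 g0 fc gc pp n al be al0 be0 al1 be1 t; left.
have s0 : 0 <= s by move: s1; clear; lra.
have p2 : 2 <= p%:R :> R by rewrite ler_nat prime_gt1.
have h1 : 1 <= ndiff_weight s C T p by apply: ndiff_weight_ge1 => //; exact: ltW.
apply: le_trans (local_all s1 s2 h1 p2 (exp_weight01 f0 fc pp) (exp_weight01 g0 gc pp)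
  al0 be0 al1 be1) _.
rewrite ler_wpM2l// /ndiff_weight; case: (T p); last by rewrite -[leLHS]expR0 ler_expR ltW.
by rewrite ler_expR ler_piMr ?ltW//; move: s2; clear; lra.
Qed.

(** [local_large] is applied with [h = 1] and with [h = e^(C s)]: for [h = 1] the term in [1 / p]
    vanishes, so primes outside [T] cost only a summable amount. *)
Lemma local_ok_large s C : 1 / 2 < s -> s <= 9 / 10 -> 0 < C ->
  exists P1 kap : R, 0 < kap /\ forall f g (T : pred nat) p,
  (forall n, (0 < n)%N -> 0 <= f n) -> (forall n, (0 < n)%N -> 0 <= g n) ->
  (forall n, (0 < n)%N -> one_conv f n <= n%:R) ->
  (forall n, (0 < n)%N -> one_conv g n <= n%:R) ->
  prime p -> P1 <= p%:R ->
  local_ok s C f g T p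
    (expR (kap * p%:R `^ (- (1 + (s - 1 / 2) / 8)) +
      (if T p then 2 * (1 - s) * (expR (C * (s / (1 - s))) - 1) / p%:R else 0))).
Proof.
move=> s1 s2 C0.
have s0 : 0 <= s by move: s1; clear; lra.
have hC : 1 <= expR (C * s) by rewrite -[leLHS]expR0 ler_expR mulr_ge0// ltW.
have [P1 [k1 [k10 l1]]] := local_large s1 s2 (lexx 1).
have [P2 [k2 [k20 l2]]] := local_large s1 s2 hC.
exists (Num.max P1 P2), (Num.max k1 k2); split; first by rewrite lt_max k10.
move=> f g T p f0 g0 fc gc pp; rewrite ge_max => /andP[p1 p2].
have pge2 : 2 <= p%:R :> R by rewrite ler_nat prime_gt1.
set N := p%:R `^ _; have N0 : 0 <= N by exact: powR_ge0.
set lam := 2 * (1 - s) * _.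
have lam0 : 0 <= lam.
  rewrite /lam !mulr_ge0 ?subr_ge0//; first by move: s2; clear; lra.
  rewrite -[leLHS]expR0 ler_expR mulr_ge0 ?(ltW C0)// divr_ge0//.
  by move: s2; clear; lra.
have Hs : expR (C * s) `^ (1 - s)^-1 = expR (C * (s / (1 - s))).
  by rewrite -expRM; congr expR; rewrite mulrA.
move=> n al be al0 be0 al1 be1 t.
set S := expR _.
have S1 : 1 <= S.
  rewrite -[leLHS]expR0 ler_expR addr_ge0 ?mulr_ge0 ?le_max ?(ltW k10)//.
  by case: (T p); rewrite ?divr_ge0.
have key h kap (hS : 1 + 2 * (1 - s) * (h `^ (1 - s)^-1 - 1) / p%:R + kap * N <= S) :
   (\sum_(i < n) \sum_(j < n) local_term s h p%:R (exp_weight f p) (exp_weight g p) al be i j <= 1 \/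
  exists k (A B : R), [/\ (0 <= A) && (0 <= B), forall i, tame_exp k i -> exp_weight f p i <= A,
    forall i, tame_exp k i -> exp_weight g p i <= B &
    \sum_(i < n) \sum_(j < n) (if tame_pair k i j then 0
        else local_term s h p%:R (exp_weight f p) (exp_weight g p) al be i j) +
    (A * B) `^ (1 - s) *
    ((\sum_(i < n | tame_exp k i) al i) * (\sum_(i < n | tame_exp k i) be i)) `^ s <=
    1 + 2 * (1 - s) * (h `^ (1 - s)^-1 - 1) / p%:R + kap * N]) ->
   h = ndiff_weight s C T p ->
   \sum_(i < n) \sum_(j < n) t i j <= S \/
   exists k (a b : R), [/\ (0 <= a) && (0 <= b),
    forall i, tame_exp k i -> exp_weight f p i <= a,
    forall i, tame_exp k i -> exp_weight g p i <= b &
    \sum_(i < n) \sum_(j < n) (if tame_pair k i j then 0 else t i j) +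
    (a * b) `^ (1 - s) *
    ((\sum_(i < n | tame_exp k i) al i) * (\sum_(i < n | tame_exp k i) be i)) `^ s <= S].
  move=> alt hh; move: alt; rewrite hh -/t => -[h1|[k [A [B [AB fA gB h2]]]]].
    by left; exact: le_trans h1 S1.
  by right; exists k, A, B; split => //; apply: le_trans h2 _; rewrite -hh.
have wf := exp_weight01 f0 fc pp; have wg := exp_weight01 g0 gc pp.
have wfS := exp_weight_succ f0 fc pp; have wgS := exp_weight_succ g0 gc pp.
have kN k : k <= Num.max k1 k2 -> k * N <= Num.max k1 k2 * N by move=> h; rewrite ler_wpM2r.
have [Tp|Tp] := boolP (T p).
  apply: (key (expR (C * s)) k2 _ (l2 _ _ _ _ _ _ p2 pge2 wf wg wfS wgS al0 be0 al1 be1)).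
    rewrite Hs -/lam /S Tp; apply: le_trans (expR_ge1Dx _).
    rewrite -addrA lerD2l addrC lerD2r kN// le_max lexx orbT//.
  by rewrite /ndiff_weight Tp.
apply: (key 1 k1 _ (l1 _ _ _ _ _ _ p1 pge2 wf wg wfS wgS al0 be0 al1 be1)).
  rewrite powR1 subrr mulr0 mul0r addr0 /S (negPf Tp) addr0; apply: le_trans (expR_ge1Dx _).
  by rewrite lerD2l kN// le_max lexx.
by rewrite /ndiff_weight (negPf Tp).
Qed.

Lemma bounded_list s C (I J : finType) f g (phi x : I -> R) (phi' y : J -> R)
    (T : pred nat) (Q : seq nat) (S : nat -> R) (L : seq nat) :
  1 / 2 < s -> s <= 9 / 10 -> 0 < C ->
  (forall i, 0 <= phi i) -> (forall i, 0 <= x i) ->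
  (forall j, 0 <= phi' j) -> (forall j, 0 <= y j) ->
  uniq Q -> all prime Q -> mult_fun f -> mult_fun g ->
  (forall n, (0 < n)%N -> 0 <= f n) -> (forall n, (0 < n)%N -> 0 <= g n) ->
  (forall p, 0 <= S p) -> (forall p, p \in L -> local_ok s C f g T p (S p)) ->
  uniq L -> all prime L -> (forall p, p \in L -> T p -> p \in Q) ->
  bounded s C f g phi x phi' y T Q L
    (omega_mean s C Q `^ (2 * (1 - s)) * \prod_(p <- L) S p).
Proof.
move=> s1 s2 C0 p0 x0 p0' y0 uQ pQ mf mg f0 g0 S0.
elim: L => [|p L IH] loc /=.
  move=> _ _ _; rewrite big_nil mulr1.
  by apply: bounded_nil => //; [case: mf|case: mg].
move=> /andP[pL uL] /andP[pp Lp] LQ; rewrite big_cons [S p * _]mulrC mulrA.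
apply: bounded_cons => //.
- apply: IH => // q qL; first by apply: loc; rewrite inE qL orbT.
  by apply: LQ; rewrite inE qL orbT.
- by rewrite mulr_ge0 ?powR_ge0// prodr_ge0.
- by apply: loc; rewrite mem_head.
- by apply: LQ; rewrite mem_head.
Qed.

Lemma prod_expR (L : seq nat) (P : pred nat) (F : nat -> R) :
  \prod_(p <- L | P p) expR (F p) = expR (\sum_(p <- L | P p) F p).
Proof.
by elim/big_rec2: _ => [|p u v _ ->]; rewrite ?expR0// expRD.
Qed.

Lemma omega_mean_le s C (Q : seq nat) : s < 1 -> 0 <= s -> 0 <= C ->
  omega_mean s C Q `^ (2 * (1 - s)) <=
  expR (2 * (1 - s) * (expR (C * (s / (1 - s))) - 1) * \sum_(p <- Q) (p%:R : R)^-1).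
Proof.
move=> s1 s0 C0; set H := expR (C * (s / (1 - s))).
have H1 : 0 <= H - 1.
  by rewrite subr_ge0 -[leLHS]expR0 ler_expR mulr_ge0// divr_ge0// subr_ge0 ltW.
have -> : expR (2 * (1 - s) * (H - 1) * \sum_(p <- Q) (p%:R : R)^-1) =
    expR ((H - 1) * \sum_(p <- Q) (p%:R : R)^-1) `^ (2 * (1 - s)).
  by rewrite -expRM; congr expR; ring.
apply: le_powR.
- by rewrite mulr_ge0// subr_ge0 ltW.
- by rewrite prodr_ge0// => p _; rewrite addr_ge0// divr_ge0.
rewrite mulr_sumr -(prod_expR Q xpredT (fun p => (H - 1) * (p%:R)^-1)).
apply: ler_prod => p _; rewrite addr_ge0 ?divr_ge0//=.
exact: expR_ge1Dx.
Qed.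

(** Bernoulli with exponent [16 (1 - s) >= 1] gives [1 + 16 (1 - s) (H - 1) <= H^(16 (1 - s)) =
    e^(16 s C)], and [16 s <= 40]. The [4] stands for two contributions, from [omega_mean] and from
    the local factors, each with the [2] of [sum_prime_inv_le]. *)
Lemma log_exponent_le s C : 1 / 2 < s -> s <= 9 / 10 -> 0 < C ->
  4 * (2 * (1 - s) * (expR (C * (s / (1 - s))) - 1)) <= (expR (40 * C) - 1) / 2.
Proof.
move=> s1 s2 C0; set H := expR (C * _).
have s0 : 0 < 1 - s by move: s2; clear; lra.
have H1 : 0 <= H - 1.
  rewrite subr_ge0 -[leLHS]expR0 ler_expR mulr_ge0 ?(ltW C0)// divr_ge0 ?(ltW s0)//.
  by move: s1; clear; lra.
have r1 : 1 <= 16 * (1 - s) by move: s2; clear; lra.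
have := powR_bernoulli_ge r1 H1.
rewrite (_ : 1 + (H - 1) = H); last by ring.
rewrite /H -expRM.
have -> : C * (s / (1 - s)) * (16 * (1 - s)) = 16 * s * C by field; rewrite gt_eqF.
have : expR (16 * s * C) <= expR (40 * C).
  by rewrite ler_expR ler_wpM2r ?(ltW C0)//; move: s2; clear; lra.
move: (expR (16 * s * C)) (expR (40 * C)) (expR (C * (s / (1 - s)))).
by clear; move=> a b h; lra.
Qed.

Lemma prod_local_le C (kap d lam p0 t : R) (L : seq nat) :
  0 <= kap -> 0 < d < 1 -> 0 <= lam -> 1 <= t -> uniq L -> all prime L ->
  \prod_(p <- L) (if p%:R <= p0 then 100 * expR C else
     expR (kap * p%:R `^ (- (1 + d)) + (if p%:R <= t then lam / p%:R else 0))) <=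
  (100 * expR C) ^+ count (fun p => p%:R <= p0) L *
  expR (kap * (1 + d^-1 + d^-1) + lam * (7 + 2 * ln (Logt t))).
Proof.
move=> kap0 d01 lam0 t1 uL pL.
rewrite (bigID (fun p : nat => p%:R <= p0))/=; apply: ler_pM.
- by apply: prodr_ge0 => p ->; rewrite mulr_ge0 ?expR_ge0.
- by apply: prodr_ge0 => p /negPf ->; rewrite expR_ge0.
- rewrite (eq_bigr (fun=> 100 * expR C)); last by move=> p ->.
  by rewrite -big_filter big_const_seq count_predT iter_mulr_1 size_filter.
rewrite (eq_bigr (fun p : nat => expR (kap * p%:R `^ (- (1 + d)) +
   (if p%:R <= t then lam / p%:R else 0)))); last by move=> p /negPf ->.
have nn p : 0 <= kap * p%:R `^ (- (1 + d)) + (if p%:R <= t then lam / p%:R else 0).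
  by rewrite addr_ge0 ?mulr_ge0 ?powR_ge0//; case: ifP => _; rewrite ?divr_ge0.
rewrite prod_expR ler_expR.
apply: (@le_trans _ _ (\sum_(p <- L) (kap * p%:R `^ (- (1 + d)) +
   (if p%:R <= t then lam / p%:R else 0)))).
  by rewrite [leLHS]big_mkcond/=; apply: ler_sum => p _; case: ifP.
rewrite big_split/=; apply: lerD.
  rewrite -mulr_sumr ler_wpM2l//; apply: sum_riemann_uniq => //.
  by apply/allP => p /(allP pL)/prime_gt0.
rewrite -big_mkcond/= -big_filter -mulr_sumr ler_wpM2l//; apply: sum_prime_inv_le => //.
- by rewrite filter_uniq.
- by apply/allP => p; rewrite mem_filter => /andP[_ /(allP pL)].
- by apply/allP => p; rewrite mem_filter => /andP[].
Qed.

(** The constant [e^cst] is at most [(e^C)^p0], the share of [p0] in the exponent; the count [n] is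
    covered by [r], and the terms in [ln (Logt t)] add up to the coefficient [4 lam]. *)
Lemma const_bound C (y lam cst p0 r t : R) (n : nat) :
  0 < C -> 0 <= p0 -> 1 <= t -> cst <= C * p0 -> n%:R <= r -> 4 * lam <= y ->
  expR (lam * (7 + 2 * ln (Logt t))) *
    ((100 * expR C) ^+ n * expR (cst - 14 * lam + lam * (7 + 2 * ln (Logt t)))) <=
  (100 * expR C) `^ (p0 + r) * Logt t `^ y.
Proof.
move=> C0 p00 t1 hc nr hy.
have L1 : 1 <= Logt t by rewrite le_max lexx.
have L0 : 0 < Logt t by apply: lt_le_trans L1.
have lnL : 0 <= ln (Logt t) by exact: ln_ge0.
have e1 : 1 <= expR C by rewrite -[leLHS]expR0 ler_expR ltW.
have b1 : expR C <= 100 * expR C by rewrite ler_peMl ?expR_ge0// ler1n.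
have b2 : 1 <= 100 * expR C by exact: le_trans b1.
have b0 : 0 < 100 * expR C by apply: lt_le_trans b2.
rewrite mulrCA -expRD powRDpos//.
have -> : Logt t `^ y = expR (y * ln (Logt t)) by rewrite /powR gt_eqF.
rewrite [leRHS]mulrAC [leRHS]mulrC; apply: ler_pM; rewrite ?expR_ge0 ?exprn_ge0 ?(ltW b0)//.
  by rewrite -powR_mulrn ?(ltW b0)//; apply: ler_powR.
have -> : lam * (7 + 2 * ln (Logt t)) + (cst - 14 * lam + lam * (7 + 2 * ln (Logt t))) =
  cst + 4 * lam * ln (Logt t) by ring.
rewrite expRD; apply: ler_pM; rewrite ?expR_ge0//.
  apply: (@le_trans _ _ (expR C `^ p0)); first by rewrite -expRM ler_expR.
  by apply: le_powR; rewrite ?expR_ge0.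
by rewrite ler_expR ler_wpM2r.
Qed.

End Assembly.

(** * Passage to finite index types, and the theorem *)

Lemma mass_fsbig (R : realType) (f psi : nat -> R) (V : set nat) (N : nat) :
  (forall v, V v -> (0 < v)%N) -> (forall n, supp psi n -> (n < N)%N) ->
  mass (fun i : 'I_N => if (0 < i)%N then f i else 0)
       (fun i : 'I_N => if (0 < i)%N then psi i / i%:R else 0)
       (fun i : 'I_N => `[< V i /\ supp psi i >]) = mu_set f psi V.
Proof.
(* Since [psi] vanishes at positive integers off its support, a possibly infinite [V] may be cut
   down to its part in the support. *)
move=> V0 hN; rewrite /mu_set -(fsbig_widen (V `&` supp psi) V).
- rewrite (@fsbig_finType R nat 'I_N (fun i => i : nat))//.
  + apply: eq_bigr => i /asboolP[_ [i0 _]].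
    by rewrite i0 /mu mulrA.
  + exact: val_inj.
  + by move=> v [_ /hN vN]; exists (Ordinal vN).
- exact: subIsetl.
move=> v [Vv nv] /=; rewrite /mu.
have -> : psi v = 0; last by rewrite mulr0 mul0r.
by apply/eqP; apply/negPn/negP => p; apply: nv; split => //; split => //; exact: V0.
Qed.

Lemma edge_mass_fsbig (R : realType) (f g psi theta : nat -> R) (V W : set nat)
    (E : set (nat * nat)) (N : nat) :
  (forall n, supp psi n -> (n < N)%N) -> (forall n, supp theta n -> (n < N)%N) ->
  (forall v w, E (v, w) -> [/\ V v, W w, supp psi v & supp theta w]) ->
  edge_mass (fun i : 'I_N => if (0 < i)%N then f i else 0)
       (fun i : 'I_N => if (0 < i)%N then psi i / i%:R else 0)
       (fun i : 'I_N => if (0 < i)%N then g i else 0)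
       (fun i : 'I_N => if (0 < i)%N then theta i / i%:R else 0)
       (fun i : 'I_N => `[< V i /\ supp psi i >])
       (fun i : 'I_N => `[< W i /\ supp theta i >])
       (fun i j : 'I_N => `[< E (i : nat, j : nat) >]) = mu2 f g psi theta E.
Proof.
move=> hN hN' hE; rewrite /mu2.
rewrite (@fsbig_finType R _ ('I_N * 'I_N)%type
  (fun u => (u.1 : nat, u.2 : nat))).
- apply: eq_big => [u|u].
    apply/and3P/asboolP => [[_ _ /asboolP //]|Eu].
    have [Vv Ww pv tw] := hE _ _ Eu.
    by split; apply/asboolP.
  move=> /and3P[/asboolP[_ [i0 _]] /asboolP[_ [j0 _]] _].
  by rewrite i0 j0 /mu !mulrA.
- by move=> [i j] [i' j'] /= [/val_inj -> /val_inj ->].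
move=> [v w] /hE[_ _ /hN vN /hN' wN].
by exists (Ordinal vN, Ordinal wN).
Qed.

Lemma Dpt_le1 (R : realType) (psi theta : nat -> R) v w : (0 < v)%N -> (0 < w)%N ->
  Dpt psi theta v w <= 1 ->
  psi v / v%:R * (lcmn v w)%:R <= 1 /\ theta w / w%:R * (lcmn v w)%:R <= 1.
Proof.
move=> v0 w0; have g0 : (0 < gcdn v w)%N by rewrite gcdn_gt0 v0.
have l0 : (0 < lcmn v w)%N by rewrite lcmn_gt0 v0.
rewrite /Dpt ler_pdivrMr ?ltr0n// mul1r ge_max => /andP[h1 h2].
have lg : (lcmn v w)%:R * (gcdn v w)%:R = v%:R * w%:R :> R.
  by rewrite -!natrM muln_lcm_gcd.
have gp : 0 < (gcdn v w)%:R :> R by rewrite ltr0n.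
have vp : 0 < v%:R :> R by rewrite ltr0n.
have wp : 0 < w%:R :> R by rewrite ltr0n.
have lE : (lcmn v w)%:R = v%:R * w%:R / (gcdn v w)%:R :> R.
  by rewrite -lg mulfK// gt_eqF.
rewrite lE; split.
  have -> : psi v / v%:R * (v%:R * w%:R / (gcdn v w)%:R) = w%:R * psi v / (gcdn v w)%:R.
    by field; rewrite !gt_eqF.
  by rewrite ler_pdivrMr// mul1r.
have -> : theta w / w%:R * (v%:R * w%:R / (gcdn v w)%:R) = v%:R * theta w / (gcdn v w)%:R.
  by field; rewrite !gt_eqF.
by rewrite ler_pdivrMr// mul1r.
Qed.

Theorem theorem1p7 (R : realType) (eps C : R) :
  0 < eps -> eps <= 2 / 5 -> 0 < C ->
  exists p0 : R, 0 < p0 /\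
  forall (psi theta f g : nat -> R) (V W : set nat) (t K : R)
         (E : set (nat * nat)),
    (forall n, (0 < n)%N -> 0 <= psi n) ->
    (forall n, (0 < n)%N -> 0 <= theta n) ->
    finite_set (supp psi) -> finite_set (supp theta) ->
    (forall n, (0 < n)%N -> 0 <= f n) ->
    (forall n, (0 < n)%N -> 0 <= g n) ->
    mult_fun f -> mult_fun g ->
    (forall n, (0 < n)%N -> one_conv f n <= n%:R) ->
    (forall n, (0 < n)%N -> one_conv g n <= n%:R) ->
    (forall v, V v -> (0 < v)%N) -> (forall w, W w -> (0 < w)%N) ->
    1 <= t ->
    E `<=` Eset psi theta t K `&` (V `*` W) ->
    mu2 f g psi theta E <=
      (100 * expR C) `^ (Pval psi theta p0)
      * (Logt t) `^ ((expR (40 * C) - 1) / 2)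
      * (mu_set f psi V * mu_set g theta W * expR (- (C * K))) `^ (1 / 2 + eps).
Proof.
move=> e0 e1 C0; set s := 1 / 2 + eps.
have s1 : 1 / 2 < s by rewrite /s ltrDl.
have s2 : s <= 9 / 10 by rewrite /s; move: e1; clear; lra.
have s0 : 0 <= s by move: s1; clear; lra.
have s3 : s < 1 by move: s2; clear; lra.
have [P1 [kap [kap0 loc]]] := local_ok_large s1 s2 C0.
pose d := (s - 1 / 2) / 8.
have d01 : 0 < d < 1.
  by rewrite /d; move: s1 s2; clear => s1 s2; apply/andP; split; lra.
pose lam := 2 * (1 - s) * (expR (C * (s / (1 - s))) - 1).
have lam0 : 0 <= lam.
  rewrite /lam !mulr_ge0 ?subr_ge0// ?(ltW s3)//.
  by rewrite -[leLHS]expR0 ler_expR mulr_ge0 ?(ltW C0)// divr_ge0// subr_ge0 ltW.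
(* All that is independent of [t] and of the supports: the convergent series over the primes, and
   [7 lam] from each of the two sums of [1 / p]. *)
pose cst := kap * (1 + d^-1 + d^-1) + 14 * lam.
(* The entry [1] gives positivity, [P1] the local bound beyond [p0], and [cst / C] makes [e^(C p0)]
   absorb [e^cst]. *)
pose p0 := Num.max (Num.max 1 P1) (cst / C).
have p0P : P1 <= p0 by rewrite !le_max lexx orbT.
have p0c : cst <= C * p0 by rewrite mulrC -ler_pdivrMr// le_max lexx orbT.
have p00 : 0 < p0 by rewrite !lt_max ltr01.
exists p0; split => // psi theta f g V W t K E psi0 theta0 fpsi ftheta f0 g0 mf mg fc gc V0 W0 t1 EE.
have hE v w : E (v, w) -> [/\ V v, W w, supp psi v & supp theta w].
  by move=> /EE[[/= sv [sw _]] [/= Vv Ww]].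
(* A prime dividing an element of one support lies in [Pset] only if the other support is nonempty;
   an edge [(v0, w0)] provides the partner. *)
have [E0|/set0P[[v0 w0] Evw]] := eqVneq E set0.
  by rewrite E0 /mu2 fsbig_set0 !mulr_ge0 ?powR_ge0.
have [_ _ sv0 sw0] := hE _ _ Evw.
have [N1 hN1] := finite_set_bounded fpsi; have [N2 hN2] := finite_set_bounded ftheta.
pose N := (N1 + N2)%N.
have hN n : supp psi n -> (n < N)%N by move=> /hN1 h; exact: leq_trans h (leq_addr _ _).
have hN' n : supp theta n -> (n < N)%N by move=> /hN2 h; exact: leq_trans h (leq_addl _ _).
rewrite -(edge_mass_fsbig f g hN hN' hE) -(mass_fsbig f V0 hN) -(mass_fsbig g W0 hN').
(* Nonnegativity is known at positive integers only, so the index [0] receives the value [0]. *)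
set phi := fun i : 'I_N => if (0 < i)%N then f i else 0.
set x := fun i : 'I_N => if (0 < i)%N then psi i / i%:R else 0.
set phi' := fun i : 'I_N => if (0 < i)%N then g i else 0.
set y := fun i : 'I_N => if (0 < i)%N then theta i / i%:R else 0.
set A := fun i : 'I_N => `[< V i /\ supp psi i >].
set B := fun i : 'I_N => `[< W i /\ supp theta i >].
set Eb := fun i j : 'I_N => `[< E (i : nat, j : nat) >].
have phi0 i : 0 <= phi i by rewrite /phi; case: ifP => // /f0.
have x0 i : 0 <= x i by rewrite /x; case: ifP => // h; rewrite divr_ge0// psi0.
have phi'0 i : 0 <= phi' i by rewrite /phi'; case: ifP => // /g0.
have y0 i : 0 <= y i by rewrite /y; case: ifP => // h; rewrite divr_ge0// theta0.
pose T (p : nat) := p%:R <= t.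
pose L := [seq p <- iota 0 N | `[< Pset psi theta p >]].
pose Q := [seq p <- L | T p].
have uL : uniq L by rewrite filter_uniq// iota_uniq.
have pL : all prime L by apply/allP => p; rewrite mem_filter => /andP[/asboolP[]].
have uQ : uniq Q by rewrite filter_uniq.
have pQ : all prime Q by apply/allP => p; rewrite mem_filter => /andP[_ /(allP pL)].
have tQ : all (fun p => p%:R <= t) Q by apply/allP => p; rewrite mem_filter => /andP[].
have inL p v w : prime p -> supp psi v -> supp theta w -> (p %| v)%N || (p %| w)%N -> p \in L.
  move=> pp sv sw pvw; rewrite mem_filter mem_iota/= add0n; apply/andP; split.
    apply/asboolP; split => //; exists v, w; split => //; split => //.
    by case/orP: pvw => h; [exact: dvdn_mulr|exact: dvdn_mull].
  case/orP: pvw => h.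
    exact: leq_ltn_trans (dvdn_leq sv.1 h) (hN _ sv).
  exact: leq_ltn_trans (dvdn_leq sw.1 h) (hN' _ sw).
pose S (p : nat) := if p%:R <= p0 then 100 * expR C else
     expR (kap * p%:R `^ (- (1 + d)) + (if p%:R <= t then lam / p%:R else 0)).
have S0 p : 0 <= S p by rewrite /S; case: ifP => _; rewrite ?mulr_ge0 ?expR_ge0.
have locS p : p \in L -> local_ok s C f g T p (S p).
  move=> /(allP pL) pp; rewrite /S; case: ifP => [_|/negbT].
    exact: local_ok_all.
  rewrite -ltNge => pp0; apply: (loc f g T p f0 g0 fc gc pp).
  exact: le_trans p0P (ltW pp0).
have LQ p : p \in L -> T p -> p \in Q by move=> pl Tp; rewrite mem_filter Tp.
have bnd := bounded_list s1 s2 C0 phi0 x0 phi'0 y0 uQ pQ mf mg f0 g0 S0 locS uL pL LQ.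
(* Initial state: nothing is removed yet, so both [r] are [1] and [c = l = 1]. *)
have sA : side f phi L A (fun=> 1%N) (fun i => i : nat) 1.
  split=> //.
  - by move=> i /asboolP[_ []].
  - by move=> i p _ /(allP pL) pp; rewrite dvdn1 neq_ltn prime_gt1 ?orbT.
  - by move=> i p /asboolP[_ si] pp pi; apply: (inL p i w0) => //; rewrite pi.
  - by move=> i /asboolP[_ [i0 _]]; rewrite /phi i0 !mul1r.
  - by move=> i i' _ _ _ /val_inj.
have sB : side g phi' L B (fun=> 1%N) (fun i => i : nat) 1.
  split=> //.
  - by move=> i /asboolP[_ []].
  - by move=> i p _ /(allP pL) pp; rewrite dvdn1 neq_ltn prime_gt1 ?orbT.
  - by move=> i p /asboolP[_ si] pp pi; apply: (inL p v0 i) => //; rewrite pi orbT.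
  - by move=> i /asboolP[_ [i0 _]]; rewrite /phi' i0 !mul1r.
  - by move=> i i' _ _ _ /val_inj.
have sE : edges x y T Q L A B Eb (fun=> 1%N) (fun i => i : nat) (fun=> 1%N) (fun i => i : nat) 1 K.
  move=> i j /asboolP[_ si] /asboolP[_ sj] /asboolP/EE[[/= _ [_ [Dij Kij]]] _].
  have [i0 _] := si; have [j0 _] := sj.
  have [h1 h2] := Dpt_le1 i0 j0 Dij.
  rewrite /x /y i0 j0 !mul1r !mul1n; split => //.
  apply: le_trans Kij _; rewrite /omega_t.
  apply: (@le_trans _ _ (exp_diff T L i j)%:R); last by rewrite ler_nat leq_addl.
  rewrite /exp_diff -size_filter; apply: rcard_le_size => p [pp [pt pd]].
  rewrite mem_filter /T pt (dvdn_lcm_gcd_logn pp i0 j0 pd)/=.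
  apply: (inL p i j) => //; rewrite -Euclid_dvdM//.
  have gd : (gcdn i j ^ 2 %| i * j)%N by rewrite -mulnn dvdn_mul ?dvdn_gcdl ?dvdn_gcdr.
  by apply: dvdn_trans pd _; rewrite -{2}(divnK gd) dvdn_mulr.
have := bnd _ _ _ _ _ _ _ _ _ _ _ ltr01 sA sB sE.
rewrite mulr1 expr1n divr1 powR1 mulr1 => /le_trans; apply.
set X := mass phi x A; set Y := mass phi' y B.
have XY0 : 0 <= X * Y by rewrite mulr_ge0// mass_ge0.
rewrite (powRM _ XY0 (expR_ge0 _)) -expRM mulNr -[leLHS]mulrA ler_wpM2r ?mulr_ge0 ?powR_ge0 ?expR_ge0//.
have om := omega_mean_le Q s3 s0 (ltW C0).
have hsum := sum_prime_inv_le t1 uQ pQ tQ.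
have pr := prod_local_le C p0 (ltW kap0) d01 lam0 t1 uL pL.
have om' : omega_mean s C Q `^ (2 * (1 - s)) <= expR (lam * (7 + 2 * ln (Logt t))).
  by apply: le_trans om _; rewrite ler_expR ler_wpM2l.
have pr0 : 0 <= \prod_(p <- L) S p by apply: prodr_ge0 => p _; exact: S0.
apply: (le_trans (ler_pM (powR_ge0 _ _) pr0 om' pr)).
have cE : kap * (1 + d^-1 + d^-1) = cst - 14 * lam by rewrite /cst addrK.
rewrite cE /Pval; apply: const_bound => //; first exact: ltW.
  rewrite -size_filter; apply: size_le_rcard.
  - apply: (@sub_finite_set _ _ [set` L]); last exact: finite_seq.
    by move=> p [[pp [v [w [sv [sw pvw]]]]] _] /=; apply: (inL p v w) => //; rewrite -Euclid_dvdM.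
  - by rewrite filter_uniq.
  - move=> p; rewrite mem_filter => /andP[pp0 plL]; split => /=.
      by move: plL; rewrite mem_filter => /andP[/asboolP].
    by rewrite pp0 prime_gt0// (allP pL).
exact: log_exponent_le.
Qed.
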